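(* Let $f:\mathbb{R}^n\to\mathbb{R}$ be differentiable with $L_f$-Lipschitz continuous gradient, let $g:\mathbb{R}^n\to\mathbb{R}\cup\{+\infty\}$ be proper, lower semicontinuous, $\gamma_g$-prox-bounded and $\rho$-weakly convex, let $\varphi=f+g$ with $\operatorname{argmin}\varphi\neq\emptyset$. Consider the iterates generated by the PGCL algorithm described in the context, and suppose $(\bar x^k)$ converges to a strong local minimizer $x^\star$ of $\varphi$ such that $f$ is of class $C^3$ locally around $x^\star$ and $\operatorname{prox}_{\gamma g}$ is of class $C^1$ locally around $x^\star-\gamma\nabla f(x^\star)$. If the directions $d^k$ satisfy the Dennis–Moré condition $$\lim_{k\to\infty}\frac{\|Q_k\bar r^k+\nabla^2\varphi_\gamma(x^\star)d^k\|}{\|d^k\|}=0,$$ then eventually the stepsize $\tau_k=1$ is always accepted and the sequences $(x^k)$, $(\bar x^k)$, $(r^k)$ converge superlinearly.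
   Context: Strong local minimizer: there exist $c,\epsilon>0$ with $\varphi(x)\ge\varphi(x^\star)+c\|x-x^\star\|^2$ whenever $\|x-x^\star\|<\epsilon$. Under the hypotheses, $\varphi_\gamma$ is $C^2$ near $x^\star$, and $\nabla^2\varphi_\gamma(x^\star)$ is its Hessian. $\gamma_g$-prox-bounded: $g+\frac1{2\gamma}\|\cdot\|^2$ bounded below for each $\gamma\in(0,\gamma_g)$; $\rho$-weakly convex: $g+\frac\rho2\|\cdot\|^2$ convex. $\operatorname{prox}_{\gamma g}(x)=\operatorname{argmin}_z\{g(z)+\frac1{2\gamma}\|z-x\|^2\}$, $T_\gamma(x)=\operatorname{prox}_{\gamma g}(x-\gamma\nabla f(x))$, $R_\gamma(x)=\gamma^{-1}(x-T_\gamma(x))$. Forward-backward envelope $\varphi_\gamma(x)=\inf_u\{f(x)+\langle\nabla f(x),u-x\rangle+g(u)+\frac1{2\gamma}\|u-x\|^2\}$. $\partial_C$: Clarke generalized Jacobian. PGCL: given $x^0$, $\gamma\in(0,\min\{1/L_f,\gamma_g\})$, $\sigma\in(0,\gamma\frac{1-\gamma L_f}{2})$, $\beta\in(0,1)$, $\mu\in(0,1)$; for $k=0,1,\dots$: select $\bar x^k\in T_\gamma(x^k)$, $r^k=\gamma^{-1}(x^k-\bar x^k)$; select $\bar r^k\in R_\gamma(\bar x^k)$, $Q_k\in I-\gamma\partial_C(\nabla f)(\bar x^k)$, $P_k\in\partial_C\operatorname{prox}_{\gamma g}(\bar x^k-\gamma\nabla f(\bar x^k))$; $B_k=\gamma^{-1}Q_k(I-P_kQ_k)$;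 stop if $\bar r^k=0$ and $\lambda_{\min}(B_k)\ge0$; select $d^k,s^k$ with $\langle Q_k\bar r^k,d^k\rangle\le0$, $\langle Q_k\bar r^k,s^k\rangle\le0$, and $\langle B_ks^k,s^k\rangle<0$ if $\lambda_{\min}(B_k)<0$, $=0$ otherwise; let $\tau_k$ be the largest element of $\{\beta^m:m\in\mathbb N\}$ such that $x^{k+1}=\bar x^k+\tau_k^2d^k+\tau_ks^k$ satisfies $\varphi_\gamma(x^{k+1})\le\varphi_\gamma(x^k)-\sigma\|r^k\|^2+\frac\mu2\tau_k^2\langle B_ks^k,s^k\rangle$. *)

(* Defs.v *)
From HB Require Import structures.
From mathcomp Require Import all_boot all_order all_algebra.
From mathcomp Require Import all_classical all_reals all_analysis.
Set Implicit Arguments.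
Unset Strict Implicit.
Unset Printing Implicit Defensive.
Import Order.TTheory GRing.Theory Num.Theory.
Import numFieldNormedType.Exports.
Local Open Scope classical_set_scope.
Local Open Scope ring_scope.

Section Defs.
Variables (R : realType) (n : nat).
Notation vec := 'cV[R]_n.
Notation mat := 'M[R]_n.

Definition dot (u v : vec) : R := \sum_(i < n) u i 0 * v i 0.
Definition enorm (u : vec) : R := Num.sqrt (dot u u).

Definition dpart {W : normedModType R} (F : vec -> W) (y : vec) (j : 'I_n) : W :=
  'd F y (delta_mx j 0).

Definition grad (F : vec -> R) (x : vec) : vec := \col_(i < n) dpart F x i.
Definition jac (F : vec -> vec) (x : vec) : mat :=
  \matrix_(i < n, j < n) (dpart F x j) i 0.
Definition hess (F : vec -> R) (x : vec) : mat :=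
  \matrix_(i < n, j < n) dpart (fun y => dpart F y j) x i.

Fixpoint Ck_near (k : nat) {W : normedModType R} (F : vec -> W) (p : vec) : Prop :=
  match k with
  | 0 => \forall y \near p, {for y, continuous F}
  | k'.+1 => (\forall y \near p, differentiable F y) /\
             forall j : 'I_n, Ck_near k' (fun z => dpart F z j) p
  end.

Definition proper_fun (g : vec -> \bar R) : Prop :=
  (forall x, g x != -oo%E) /\ (exists x, g x != +oo%E).

Definition prox_bounded (gg : \bar R) (g : vec -> \bar R) : Prop :=
  forall gam : R, 0 < gam -> (gam%:E < gg)%E ->
    exists b : R, forall x, (b%:E <= g x + (enorm x ^+ 2 / (2 * gam))%:E)%E.

Definition convex_efun (h : vec -> \bar R) : Prop :=
  forall (x y : vec) (t : R), 0 <= t -> t <= 1 ->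
    (h (t *: x + (1 - t) *: y)%R <= t%:E * h x + (1 - t)%:E * h y)%E.

Definition weakly_convex (rho : R) (g : vec -> \bar R) : Prop :=
  convex_efun (fun x => g x + (rho / 2 * enorm x ^+ 2)%:E)%E.

Definition prox (gam : R) (g : vec -> \bar R) (x : vec) : set vec :=
  [set z | forall w, (g z + (enorm (z - x) ^+ 2 / (2 * gam))%:E
                      <= g w + (enorm (w - x) ^+ 2 / (2 * gam))%:E)%E].

Definition Tfb (gam : R) (f : vec -> R) (g : vec -> \bar R) (x : vec) : set vec :=
  prox gam g (x - gam *: grad f x).
Definition Rfb (gam : R) (f : vec -> R) (g : vec -> \bar R) (x : vec) : set vec :=
  [set gam^-1 *: (x - z) | z in Tfb gam f g x].

Definition fbe (gam : R) (f : vec -> R) (g : vec -> \bar R) (x : vec) : \bar R :=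
  ereal_inf [set ((f x + dot (grad f x) (u - x))%:E + g u
                  + (enorm (u - x) ^+ 2 / (2 * gam))%:E)%E | u in [set: vec]].

Definition sv_diff_at (S : vec -> set vec) (y : vec) (J : mat) : Prop :=
  exists F : vec -> vec, (\forall z \near y, S z = [set F z]) /\
    differentiable F y /\ jac F y = J.

Definition Bsubdiff (S : vec -> set vec) (x : vec) (M : mat) : Prop :=
  exists (ys : nat -> vec) (Js : nat -> mat),
    ys @ \oo --> x /\ (forall k, sv_diff_at S (ys k) (Js k)) /\ Js @ \oo --> M.

Definition clarke_jac (S : vec -> set vec) (x : vec) (M : mat) : Prop :=
  exists (m : nat) (lam : 'I_m -> R) (Ms : 'I_m -> mat),
    (forall i, 0 <= lam i) /\ \sum_(i < m) lam i = 1 /\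
    (forall i, Bsubdiff S x (Ms i)) /\ M = \sum_(i < m) lam i *: Ms i.

Definition lambda_min_nonneg (B : mat) : Prop := forall a : R, eigenvalue B a -> 0 <= a.

Definition Bmat (gam : R) (Q P : mat) : mat := gam^-1 *: (Q *m (1%:M - P *m Q)).

Definition prox_C1_near (gam : R) (g : vec -> \bar R) (p : vec) : Prop :=
  exists F : vec -> vec, (\forall y \near p, prox gam g y = [set F y]) /\ Ck_near 1 F p.

Definition strong_local_min (phi : vec -> \bar R) (xs : vec) : Prop :=
  exists c e : R, 0 < c /\ 0 < e /\
    forall x, enorm (x - xs) < e -> (phi xs + (c * enorm (x - xs) ^+ 2)%:E <= phi x)%E.

Definition superlinear (u : nat -> vec) (l : vec) : Prop :=
  u @ \oo --> l /\
  exists eps : nat -> R, eps @ \oo --> 0 /\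
    \forall k \near \oo, enorm (u k.+1 - l) <= eps k * enorm (u k - l).

End Defs.

(* Main.v *)
(** Near the strong local minimizer [xstar] the forward-backward envelope [W] is differentiable
    with gradient [Q R], where [R y = (y - T y) / gam] and [Q = I - gam * jac (grad f)].
    Since [R xstar = 0], this gradient is differentiable at [xstar] with Jacobian
    [Q (I - P Q) / gam], which is therefore the Hessian of [W]; it is coercive because [W]
    inherits quadratic growth from [f + g] through
    [W y >= (f + g)(T y) + (1 - gam Lf) / (2 gam) |T y - y|^2].
    Hence [B_k] is eventually coercive, which forces [s^k = 0], and the Dennis-More condition
    turns [xbar^k + d^k] into a quasi-Newton step with
    [|xbar^k + d^k - xstar| = o(|xbar^k - xstar|)].  The unit step is then accepted, since
    [W (xbar^k + d^k) - W xstar = o(|xbar^k - xstar|^2)] whereas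
    [W (x^k) - sigma |r^k|^2 - W xstar >= c |xbar^k - xstar|^2]. *)

Require Import Defs.
From HB Require Import structures.
From mathcomp Require Import all_boot all_order all_algebra.
From mathcomp Require Import all_classical all_reals all_analysis.
From mathcomp Require Import ring lra.
Set Implicit Arguments.
Unset Strict Implicit.
Unset Printing Implicit Defensive.
Import Order.TTheory GRing.Theory Num.Theory.
Import numFieldNormedType.Exports.
Local Open Scope classical_set_scope.
Local Open Scope ring_scope.

(** * Euclidean geometry of column vectors, compared with the max-norm topology *)

Section Euclidean.
Variables (R : realType) (n : nat).
Implicit Types (u v w x y : 'cV[R]_n) (a : R) (M N : 'M[R]_n).

(** The equation [T xstar = xstar], on which [R xstar = 0] rests, comes from the run and not from
    minimality: the line search makes [W (x k)] drop by at least [sigma |r k|^2], and [W] is bounded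
    below by the minimum of [f + g], so [r k] tends to 0, [x k] has the same limit as [xbar k], and
    continuity of [T] gives the fixed point.

    The gradient of [W] is differentiated at the single point [xstar], so all second-order
    information is drawn from one expansion of the gradient there. Symmetry of the Hessian is
    obtained from second differences, and the quadratic bounds from the mean value theorem on
    segments issuing from [xstar], where an unknown factor [s] in (0,1) stands in place of the 1/2
    of Taylor's formula. The loss is harmless: coercivity, acceptance of the unit step and the rates
    ask only for some positive constant. *)

Lemma dotE u v : dot u v = (u^T *m v) 0 0.
Proof. by rewrite mxE; apply: eq_bigr => i _; rewrite mxE. Qed.

Lemma dotC u v : dot u v = dot v u.
Proof. by apply: eq_bigr => i _; rewrite mulrC. Qed.

Lemma dotDr u v w : dot u (v + w) = dot u v + dot u w.
Proof. by rewrite !dotE mulmxDr mxE. Qed.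

Lemma dotZr a u v : dot u (a *: v) = a * dot u v.
Proof. by rewrite !dotE -scalemxAr mxE. Qed.

Lemma dotNr u v : dot u (- v) = - dot u v.
Proof. by rewrite -scaleN1r dotZr mulN1r. Qed.

Lemma dotDl u v w : dot (u + v) w = dot u w + dot v w.
Proof. by rewrite dotC dotDr !(dotC w). Qed.

Lemma dotZl a u v : dot (a *: u) v = a * dot u v.
Proof. by rewrite dotC dotZr (dotC v). Qed.

Lemma dotNl u v : dot (- u) v = - dot u v.
Proof. by rewrite dotC dotNr (dotC v). Qed.

Lemma dot0r u : dot u 0 = 0.
Proof. by rewrite -(scale0r u) dotZr mul0r. Qed.

Lemma dot_trmx M u v : dot (M *m u) v = dot u (M^T *m v).
Proof. by rewrite !dotE trmx_mul mulmxA. Qed.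

Definition dotE_lin := (dotDl, dotDr, dotNl, dotNr, dotZl, dotZr).

Lemma dot_ge0 u : 0 <= dot u u.
Proof. by apply: sumr_ge0 => i _; rewrite -expr2 sqr_ge0. Qed.

Lemma sqr_enorm u : enorm u ^+ 2 = dot u u.
Proof. by rewrite sqr_sqrtr ?dot_ge0. Qed.

Lemma enorm_ge0 u : 0 <= enorm u.
Proof. exact: sqrtr_ge0. Qed.

Lemma ler_abs_enorm u (i : 'I_n) : `|u i 0| <= enorm u.
Proof.
rewrite -sqrtr_sqr; apply: ler_wsqrtr.
rewrite /dot (bigD1 i) //= -expr2 lerDl; apply: sumr_ge0 => j _.
by rewrite -expr2 sqr_ge0.
Qed.

Lemma enorm0 : enorm (0 : 'cV[R]_n) = 0.
Proof. by rewrite /enorm dot0r sqrtr0. Qed.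

Lemma enorm_le0 u : enorm u <= 0 -> u = 0.
Proof.
move=> u0; apply/colP => i; apply/eqP; rewrite mxE -normr_le0.
exact: le_trans (ler_abs_enorm u i) u0.
Qed.

Lemma enorm_eq0 u : enorm u = 0 -> u = 0.
Proof. by move=> u0; apply: enorm_le0; rewrite u0. Qed.

Lemma enormZ a u : enorm (a *: u) = `|a| * enorm u.
Proof. by rewrite /enorm !dotE_lin mulrA -expr2 sqrtrM ?sqr_ge0 // sqrtr_sqr. Qed.

Lemma enormN u : enorm (- u) = enorm u.
Proof. by rewrite /enorm !dotE_lin opprK. Qed.

Lemma enormBC u v : enorm (u - v) = enorm (v - u).
Proof. by rewrite -enormN opprB. Qed.

(** Cauchy-Schwarz, from the nonnegative square of [enorm v *: u - enorm u *: v]. *)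
Lemma dot_le_enorm u v : dot u v <= enorm u * enorm v.
Proof.
have [v0|v0] := eqVneq (enorm v) 0.
  by rewrite (enorm_eq0 v0) dot0r enorm0 mulr0.
have vp : 0 < enorm v by rewrite lt_def v0 enorm_ge0.
have [u0|u0] := eqVneq (enorm u) 0.
  by rewrite (enorm_eq0 u0) dotC dot0r enorm0 mul0r.
have up : 0 < enorm u by rewrite lt_def u0 enorm_ge0.
have := dot_ge0 (enorm v *: u - enorm u *: v).
rewrite !dotE_lin (dotC v u) -!sqr_enorm => h.
rewrite -(ler_pM2l (mulr_gt0 up vp)); nra.
Qed.

Lemma abs_dot_le u v : `|dot u v| <= enorm u * enorm v.
Proof.
by rewrite ler_norml dot_le_enorm lerNl -dotNl -(enormN u) dot_le_enorm.
Qed.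

Lemma ler_enormD u v : enorm (u + v) <= enorm u + enorm v.
Proof.
rewrite -(@ler_pXn2r _ 2) ?nnegrE ?addr_ge0 ?enorm_ge0 //.
rewrite sqrrD !sqr_enorm !dotE_lin (dotC v u).
have := dot_le_enorm u v; lra.
Qed.

Lemma ler_enormB u v : enorm (u - v) <= enorm u + enorm v.
Proof. by rewrite -(enormN v) ler_enormD. Qed.

Lemma ler_enorm_dist (w u v : 'cV[R]_n) :
  enorm (u - v) <= enorm (u - w) + enorm (w - v).
Proof. by have := ler_enormD (u - w) (w - v); rewrite addrA subrK. Qed.

Lemma ler_enorm_sum u : enorm u <= \sum_(i < n) `|u i 0|.
Proof.
have s0 : 0 <= \sum_(i < n) `|u i 0| by apply: sumr_ge0.
rewrite -(@ler_pXn2r _ 2) ?nnegrE ?enorm_ge0 // sqr_enorm expr2 mulr_suml.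
apply: ler_sum => i _; apply: le_trans (ler_norm _) _.
by rewrite normrM ler_wpM2l // (bigD1 i) //= lerDl sumr_ge0.
Qed.

Lemma ler_coord_norm u (i : 'I_n) : `|u i 0| <= `|u|.
Proof.
rewrite {2}/Num.norm /= mx_normrE.
exact: (le_bigmax 0 (fun ij : 'I_n * 'I_1 => `|u ij.1 ij.2|) (i, 0)).
Qed.

Lemma enorm_le_norm u : enorm u <= n%:R * `|u|.
Proof.
apply: le_trans (ler_enorm_sum u) _.
have -> : n%:R * `|u| = \sum_(i < n) `|u| by rewrite sumr_const card_ord mulr_natl.
by apply: ler_sum => i _; exact: ler_coord_norm.
Qed.

Lemma norm_le_enorm u : `|u| <= enorm u.
Proof.
rewrite {1}/Num.norm /= mx_normrE; apply/bigmax_leP; split; first exact: enorm_ge0.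
by move=> [i j] _ /=; rewrite ord1 ler_abs_enorm.
Qed.

(* The library's topology on ['cV[R]_n] comes from the max-norm. *)
Lemma nbhs_enorm x (U : set 'cV[R]_n) :
  nbhs x U <-> exists2 e : R, 0 < e & forall y, enorm (y - x) < e -> U y.
Proof.
split=> [/nbhs_ballP[e /= e0 eU]|[e e0 eU]].
  exists e => // y ye; apply: eU.
  rewrite -ball_normE /= distrC; exact: le_lt_trans (norm_le_enorm _) ye.
(* [n.+1] instead of [n] keeps the divisor positive when [n = 0]; the same divisor recurs below. *)
apply/nbhs_ballP; exists (e / n.+1%:R) => /=; first exact: divr_gt0.
move=> y; rewrite -ball_normE /= distrC ltr_pdivlMr // mulrC => h.
apply: eU; apply: le_lt_trans (enorm_le_norm _) _; apply: le_lt_trans h.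
by rewrite ler_wpM2r // ler_nat.
Qed.

Lemma near_enorm_lt x (e : R) : 0 < e -> \forall y \near x, enorm (y - x) < e.
Proof. by move=> e0; apply/nbhs_enorm; exists e. Qed.

Lemma cvg_enorm (T : Type) (F : set_system T) {FF : Filter F}
    (u : T -> 'cV[R]_n) x :
  u @ F --> x <-> forall e : R, 0 < e -> \forall t \near F, enorm (u t - x) < e.
Proof.
split=> [ux e e0|ux].
  by apply: (ux (fun y => enorm (y - x) < e)); exact: near_enorm_lt.
move=> U /nbhs_enorm[e e0 eU]; near=> t; apply: eU.
by near: t; exact: ux.
Unshelve. all: by end_near. Qed.

(** A crude upper bound for the operator norm; it suffices because matrices enter the estimates only
    through constants and through differences tending to 0. *)
Definition mnorm M : R := \sum_(i < n) \sum_(j < n) `|M i j|.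

Lemma mnorm_ge0 M : 0 <= mnorm M.
Proof. by apply: sumr_ge0 => i _; apply: sumr_ge0. Qed.

Lemma enorm_mulmx M u : enorm (M *m u) <= mnorm M * enorm u.
Proof.
apply: le_trans (ler_enorm_sum _) _; rewrite /mnorm mulr_suml.
apply: ler_sum => i _; rewrite mxE; apply: le_trans (ler_norm_sum _ _ _) _.
rewrite mulr_suml; apply: ler_sum => j _; rewrite normrM.
by rewrite ler_wpM2l // ler_abs_enorm.
Qed.

Lemma mnorm_cvg (T : Type) (F : set_system T) {FF : Filter F}
    (A : T -> 'M[R]_n) M :
  (forall i j, (fun t => A t i j) @ F --> M i j) ->
  forall e : R, 0 < e -> \forall t \near F, mnorm (A t - M) < e.
Proof.
move=> AM e e0.
suff : (fun t => mnorm (A t - M)) @ F --> 0.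
  move=> /cvgr0Pnorm_lt /(_ _ e0); apply: filterS => t.
  by rewrite ger0_norm ?mnorm_ge0.
rewrite -(_ : \sum_(i < n) \sum_(j < n) (0 : R) = 0); last first.
  by rewrite big1 // => i _; rewrite big1.
apply: cvg_big => [|i _]; first exact: add_continuous.
apply: cvg_big => [|j _]; first exact: add_continuous.
rewrite -(@normr0 _ R); apply: cvg_norm.
under eq_fun do rewrite !mxE.
by rewrite -(subrr (M i j)); apply: cvgB (AM i j) (cvg_cst _).
Qed.

End Euclidean.

(** * Fréchet derivatives in epsilon form, mean values, symmetry of second derivatives *)

Section Frechet.
Variables (R : realType) (n : nat).
Local Notation vec := 'cV[R]_n.
Local Notation mat := 'M[R]_n.

Lemma colE_sum_delta (h : vec) : h = \sum_(j < n) h j 0 *: delta_mx j 0.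
Proof.
by rewrite {1}[h]matrix_sum_delta; apply: eq_bigr => j _; rewrite big_ord1.
Qed.

Lemma linear_cV_continuous (W : normedModType R) (df : {linear vec -> W}) :
  continuous df.
Proof.
apply: linear_continuous; apply/eqO_exP.
exists (\sum_(j < n) `|df (delta_mx j 0)| + 1).
  by apply: ltr_wpDl => //; apply: sumr_ge0.
apply/nbhs_enorm; exists 1 => // y; rewrite subr0 => y1.
rewrite [X in _ * X](_ : _ = 1) ?mulr1; last by rewrite /cst /= normr1.
rewrite [y in df y]colE_sum_delta linear_sum; apply: le_trans (ler_norm_sum _ _ _) _.
apply: ler_wpDr => //; apply: ler_sum => j _; rewrite linearZ /= normrZ.
rewrite ler_piMl //; apply: le_trans (ler_abs_enorm _ _) _; exact: ltW.
Qed.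

Lemma diff_frechet (W : normedModType R) (F : vec -> W) x : differentiable F x ->
  forall e : R, 0 < e ->
  \forall y \near x, `|F y - F x - 'd F x (y - x)| <= e * enorm (y - x).
Proof.
move=> /diff_locally/eqaddoP Fd e e0.
have /nbhs_enorm[d d0 dF] := Fd _ e0.
apply/nbhs_enorm; exists d => // y yd.
have := dF (y - x); rewrite subr0 => /(_ yd); rewrite /= => h.
rewrite -addrA -opprD; apply: le_trans (_ : _ <= e * `|y - x|) _.
  by apply: le_trans h; rewrite /= !fctE /= subrK.
by rewrite ler_pM2l // norm_le_enorm.
Qed.

(** The library's ['d] is a chosen linear map; it is [df] by uniqueness of a continuous
    differential, every linear map on column vectors being continuous. *)
Lemma frechet_diff (W : normedModType R) (F : vec -> W) x (df : {linear vec -> W}) :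
  (forall e : R, 0 < e ->
    \forall y \near x, `|F y - F x - df (y - x)| <= e * enorm (y - x)) ->
  differentiable F x /\ 'd F x = df :> (vec -> W).
Proof.
move=> Fd.
have dF : F \o shift x = cst (F x) + df +o_ (0 : vec) id.
  apply/eqaddoP => e e0.
  have e'0 : 0 < e / n.+1%:R by rewrite divr_gt0.
  have /nbhs_enorm[d d0 dF] := Fd _ e'0.
  apply/nbhs_enorm; exists d => // h; rewrite subr0 => hd.
  have := dF (h + x); rewrite addrK => /(_ hd) {}dF.
  rewrite /= !fctE /= opprD addrA; apply: le_trans dF _.
  rewrite -mulrA ler_pM2l // ler_pdivrMl //; apply: le_trans (enorm_le_norm _) _.
  by rewrite ler_wpM2r // ler_nat.
have df_cont := @linear_cV_continuous W df.
have dFE := diff_unique df_cont dF.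
by split=> //; apply/diff_locallyP; rewrite dFE.
Qed.

(** Differentiability with a prescribed derivative, here and in [hasjac]: the epsilon form combines
    directly with [near] estimates in the Euclidean norm, and survives replacing the function by one
    equal to it near [x]. *)
Definition hasgrad (W : vec -> R) (x v : vec) : Prop :=
  forall e : R, 0 < e ->
    \forall y \near x, `|W y - W x - dot v (y - x)| <= e * enorm (y - x).

Definition hasjac (F : vec -> vec) (x : vec) (J : mat) : Prop :=
  forall e : R, 0 < e ->
    \forall y \near x, enorm (F y - F x - J *m (y - x)) <= e * enorm (y - x).

Lemma diffE_dot (W : vec -> R) x h : 'd W x h = dot (grad W x) h.
Proof.
rewrite [h in LHS]colE_sum_delta linear_sum; apply: eq_bigr => j _.
by rewrite linearZ /= [in RHS]mxE mulrC.
Qed.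

Lemma hasgrad_grad (W : vec -> R) x : differentiable W x -> hasgrad W x (grad W x).
Proof.
move=> dW e e0; apply: filterS (diff_frechet dW e0) => y.
by rewrite diffE_dot.
Qed.

Lemma hasgrad_diff (W : vec -> R) x v : hasgrad W x v ->
  differentiable W x /\ grad W x = v.
Proof.
move=> Wv.
have dv_lin : linear (dot v : vec -> R) by move=> a y z; rewrite dotDr dotZr.
pose dvM := GRing.isLinear.Build _ _ _ _ _ dv_lin.
pose dv : {linear vec -> R} := HB.pack (dot v : vec -> R) dvM.
have [dW dWE] := @frechet_diff _ W x dv Wv.
split=> //; apply/colP => j; rewrite mxE /dpart dWE.
rewrite -[LHS]/(dot v (delta_mx j 0)) /dot (bigD1 j) //= big1 => [|i ij].
  by rewrite mxE !eqxx mulr1 addr0.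
by rewrite mxE (negbTE ij) mulr0.
Qed.

Lemma hasjac_jac (F : vec -> vec) x : differentiable F x -> hasjac F x (jac F x).
Proof.
move=> dF e e0; have e'0 : 0 < e / n.+1%:R by rewrite divr_gt0.
apply: filterS (diff_frechet dF e'0) => y.
suff -> : 'd F x (y - x) = jac F x *m (y - x).
  move=> h; apply: le_trans (enorm_le_norm _) _.
  apply: le_trans (ler_wpM2l _ h) _ => //.
  rewrite mulrA ler_wpM2r ?enorm_ge0 // mulrCA ger_pMr // ler_pdivrMr // mul1r.
  by rewrite ler_nat.
rewrite [y - x in LHS]colE_sum_delta linear_sum; apply/colP => i.
rewrite summxE [in RHS]mxE; apply: eq_bigr => j _.
by rewrite linearZ /= [in LHS]mxE [jac _ _ _ _]mxE mulrC.
Qed.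

Lemma hasjac_diff (F : vec -> vec) x J : hasjac F x J ->
  differentiable F x /\ jac F x = J.
Proof.
move=> FJ.
have [|dF dFE] := @frechet_diff _ F x (mulmx J).
  move=> e e0; apply: filterS (FJ _ e0) => y; apply: le_trans; exact: norm_le_enorm.
split=> //; apply/matrixP => i j; rewrite mxE /dpart dFE.
by rewrite -[RHS]/(J i j) -[LHS]/((J *m delta_mx j 0) i 0) -colE mxE.
Qed.

Lemma hasjac_row (F : vec -> vec) x J : hasjac F x J <->
  forall i, hasgrad (fun y => F y i 0) x (\col_j J i j).
Proof.
have E i y : dot (\col_j J i j) (y - x) = (J *m (y - x)) i 0.
  by rewrite mxE; apply: eq_bigr => j _; rewrite mxE.
split=> [FJ i e e0|FJ e e0].
  apply: filterS (FJ _ e0) => y; apply: le_trans.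
  by apply: le_trans (ler_abs_enorm _ i); rewrite E !mxE.
have e'0 : 0 < e / n.+1%:R by rewrite divr_gt0.
have := filter_forall (nbhs_filter x) (fun i => FJ i _ e'0).
apply: filterS => y h; apply: le_trans (ler_enorm_sum _) _.
apply: (@le_trans _ _ (\sum_(i < n) (e / n.+1%:R * enorm (y - x)))).
  by apply: ler_sum => i _; move: (h i); rewrite E !mxE.
rewrite sumr_const card_ord -[leLHS]mulr_natl mulrA ler_wpM2r ?enorm_ge0 //.
by rewrite mulrCA ger_pMr // ler_pdivrMr // mul1r ler_nat.
Qed.

Lemma hasgrad_near (V W : vec -> R) x v :
  (\forall y \near x, W y = V y) -> hasgrad W x v -> hasgrad V x v.
Proof.
move=> WV Wv e e0; near=> y.
rewrite -(nbhs_singleton WV) -(near WV y) //; by near: y; exact: Wv.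
Unshelve. all: by end_near. Qed.

Lemma hasjac_near (F G : vec -> vec) x J :
  (\forall y \near x, F y = G y) -> hasjac F x J -> hasjac G x J.
Proof.
move=> FG FJ e e0; near=> y.
rewrite -(nbhs_singleton FG) -(near FG y) //; by near: y; exact: FJ.
Unshelve. all: by end_near. Qed.

Lemma hasgradB (V W : vec -> R) x v w : hasgrad V x v -> hasgrad W x w ->
  hasgrad (fun y => V y - W y) x (v - w).
Proof.
move=> Vv Ww e e0; have e2 : 0 < e / 2 by rewrite divr_gt0.
near=> y; have h1 : `|V y - V x - dot v (y - x)| <= e / 2 * enorm (y - x).
  by near: y; exact: Vv.
have h2 : `|W y - W x - dot w (y - x)| <= e / 2 * enorm (y - x).
  by near: y; exact: Ww.
rewrite dotDl dotNl.
have -> : V y - W y - (V x - W x) - (dot v (y - x) - dot w (y - x)) =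
  (V y - V x - dot v (y - x)) - (W y - W x - dot w (y - x)) by ring.
apply: le_trans (ler_normB _ _) _; lra.
Unshelve. all: by end_near. Qed.

Lemma hasgrad_shift (W : vec -> R) a x v : hasgrad W (x + a) v ->
  hasgrad (fun y => W (y + a)) x v.
Proof.
move=> Wv e e0; have /nbhs_enorm[d d0 dW] := Wv _ e0.
apply/nbhs_enorm; exists d => // y yd; have := dW (y + a).
by rewrite opprD addrACA subrr addr0; apply.
Qed.

Lemma hasgrad_sqr_dist (c : R) (z x : vec) :
  hasgrad (fun y => c * enorm (y - z) ^+ 2) x ((2 * c) *: (x - z)).
Proof.
move=> e e0; have k0 : 0 < e / (`|c| + 1) by rewrite divr_gt0 // ltr_wpDl.
near=> y.
have yx : enorm (y - x) <= e / (`|c| + 1).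
  by apply: ltW; near: y; exact: near_enorm_lt.
have -> : y - z = (x - z) + (y - x) by rewrite [RHS]addrC addrA subrK.
rewrite !sqr_enorm; move: yx; move: (x - z) (y - x) => p q yx.
rewrite !dotE_lin (dotC q p).
have -> : c * (dot p p + dot p q + (dot p q + dot q q)) - c * dot p p
   - 2 * c * dot p q = c * dot q q by ring.
rewrite -sqr_enorm normrM (ger0_norm (sqr_ge0 _)) expr2 mulrA.
rewrite ler_wpM2r ?enorm_ge0 //.
move: yx; rewrite ler_pdivlMr ?ltr_wpDl //; have := enorm_ge0 q; nra.
Unshelve. all: by end_near. Qed.

Lemma is_derive_line (W : vec -> R) (x h v : vec) (t : R) :
  hasgrad W (x + t *: h) v -> is_derive t 1 (fun s : R => W (x + s *: h)) (dot v h).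
Proof.
move=> Wv; have [dW gW] := hasgrad_diff Wv.
have dl : is_diff t (cst x + (fun s : R => s *: h)) (0 + (fun s : R => s *: h)).
  exact: is_diffD.
have dl' : differentiable (fun s : R => x + s *: h) t by exact: ex_diff.
have dWl : differentiable (W \o (fun s : R => x + s *: h)) t.
  exact: differentiable_comp.
have dv : derivable (W \o (fun s : R => x + s *: h)) t 1.
  exact: diff_derivable.
apply: DeriveDef dv _; rewrite deriveE // diff_comp // /=.
have -> : 'd (fun s : R => x + s *: h) t = (0 + (fun s : R => s *: h)) :> (R -> vec).
  exact: diff_val.
by rewrite -gW add0r scale1r diffE_dot.
Qed.

Lemma MVT_line (W : vec -> R) (x h : vec) (v : R -> vec) :
  (forall t, 0 <= t <= 1 -> hasgrad W (x + t *: h) (v t)) ->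
  exists2 t, 0 < t < 1 & W (x + h) - W x = dot (v t) h.
Proof.
move=> Wv.
have [t t01||t] := @MVT R (fun s : R => W (x + s *: h)) (fun t => dot (v t) h) 0 1 ltr01.
- by apply: is_derive_line; apply: Wv; rewrite !ltW ?(itvP t01).
- apply: derivable_within_continuous => t t01.
  by have [] := is_derive_line (Wv t _); rewrite -?in_itv.
- rewrite in_itv /= => t01; rewrite scale1r scale0r addr0 subr0 mulr1 => E.
  by exists t.
Qed.

(** The mean value theorem for [y |-> W (y + t v) - W y] along [t u] yields a difference of two
    gradients. Each is expanded at [x], where the derivative of [G] is known; the terms along [u]
    cancel and leave [t J v], with errors proportional to distances from [x] of at most [t |u|] and
    [t (|u| + |v|)]. *)
Lemma hasjac_second_difference (W : vec -> R) (G : vec -> vec) x J (u v : vec) :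
  (\forall y \near x, hasgrad W y (G y)) -> hasjac G x J ->
  forall e : R, 0 < e -> exists2 d : R, 0 < d & forall t : R, 0 < t < d ->
    `|W (x + t *: u + t *: v) - W (x + t *: u) - W (x + t *: v) + W x
      - t ^+ 2 * dot (J *m v) u|
    <= t ^+ 2 * e * ((2 * enorm u + enorm v) * enorm u).
Proof.
move=> /nbhs_enorm[d1 d10 WG] GJ e e0.
have /nbhs_enorm[d2 d20 GJe] := GJ _ e0.
pose K := enorm u + enorm v + 1.
have K0 : 0 < K by rewrite ltr_wpDl // addr_ge0 ?enorm_ge0.
pose d := Num.min d1 d2.
have d0 : 0 < d by rewrite lt_min d10.
have [dd1 dd2] : d <= d1 /\ d <= d2 by split; rewrite ge_min lexx ?orbT.
exists (d / K); first exact: divr_gt0.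
move=> t /andP[t0]; rewrite ltr_pdivlMr // => tK.
have u0 := enorm_ge0 u; have v0 := enorm_ge0 v.
pose p s := s *: (t *: u).
have pE s : 0 <= s <= 1 -> enorm (p s) <= t * enorm u /\
    enorm (p s + t *: v) <= t * (enorm u + enorm v).
  move=> /andP[s0 s1].
  have h : enorm (p s) <= t * enorm u.
    rewrite /p !enormZ (ger0_norm s0) (gtr0_norm t0) ler_piMl // mulr_ge0 //.
    exact: ltW.
  split=> //; apply: le_trans (ler_enormD _ _) _; rewrite mulrDr lerD //.
  by rewrite enormZ gtr0_norm.
have small w : enorm w <= t * (enorm u + enorm v) -> enorm w < d.
  move=> h; apply: le_lt_trans h _; apply: le_lt_trans tK.
  by rewrite ler_pM2l // lerDl.
have psmall s : 0 <= s <= 1 -> enorm (p s) < d /\ enorm (p s + t *: v) < d.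
  move=> /pE[h1 h2]; split; apply: small => //; apply: le_trans h1 _.
  by rewrite ler_pM2l // lerDl.
have xK (a : vec) : x + a - x = a by rewrite addrC addKr.
have xK2 (a b : vec) : x + a + b - x = a + b by rewrite -(addrA x) xK.
have [s s01|s s01 E] := @MVT_line (fun y => W (y + t *: v) - W y) x (t *: u)
    (fun s => G (x + p s + t *: v) - G (x + p s)).
  have [h1 h2] := psmall s s01; apply: hasgradB.
    apply: hasgrad_shift; apply: WG; rewrite xK2.
    exact: lt_le_trans h2 dd1.
  apply: WG; rewrite xK; exact: lt_le_trans h1 dd1.
have s01' : 0 <= s <= 1 by case/andP: s01 => *; rewrite !ltW.
have [h1 h2] := psmall s s01'; have [h3 h4] := pE s s01'.
have := GJe (x + p s + t *: v); have := GJe (x + p s).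
rewrite -[x + p s + _]addrA ![x + _ - x]addrAC !subrr !add0r.
move=> /(_ (lt_le_trans h1 dd2)) b1 /(_ (lt_le_trans h2 dd2)) b2.
set E1 := (X in enorm X <= e * enorm (p s)) in b1.
set E2 := (X in enorm X <= _) in b2.
rewrite -[x + p s + _]addrA in E.
have GE : G (x + (p s + t *: v)) - G (x + p s) = t *: (J *m v) + (E2 - E1).
  rewrite /E1 /E2 mulmxDr -(scalemxAr t J v); move: (J *m p s) (J *m v) (G _) (G _) (G x).
  by move=> a b c c' c''; apply/colP => i; rewrite !mxE; ring.
rewrite GE dotDl dotZl dotZr in E.
have -> : W (x + t *: u + t *: v) - W (x + t *: u) - W (x + t *: v) + W x
      - t ^+ 2 * dot (J *m v) u = t * dot (E2 - E1) u.
  rewrite dotZr in E.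
  have -> : t ^+ 2 * dot (J *m v) u = t * (t * dot (J *m v) u) by ring.
  lra.
rewrite normrM (gtr0_norm t0) expr2 -!mulrA ler_pM2l //.
apply: le_trans (abs_dot_le _ _) _; rewrite !mulrA ler_wpM2r //.
apply: le_trans (ler_enormB _ _) _.
apply: (@le_trans _ _ (e * (t * (enorm u + enorm v)) + e * (t * enorm u))).
  apply: lerD; [apply: le_trans b2 _|apply: le_trans b1 _]; by rewrite ler_pM2l.
by rewrite le_eqVlt; apply/orP; left; apply/eqP; ring.
Qed.

(* Schwarz: [<J v, u>] and [<J u, v>] are limits of the same second difference quotient. *)
Lemma hasjac_grad_sym (W : vec -> R) (G : vec -> vec) x J :
  (\forall y \near x, hasgrad W y (G y)) -> hasjac G x J -> J^T = J.
Proof.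
move=> WG GJ.
have sym u v : dot (J *m v) u = dot (J *m u) v.
  apply/eqP; rewrite -subr_eq0 -normr_le0; apply/ler_addgt0Pl => e e0.
  rewrite addr0.
  pose K := (2 * enorm u + enorm v) * enorm u + (2 * enorm v + enorm u) * enorm v + 1.
  have u0 := enorm_ge0 u; have v0 := enorm_ge0 v.
  have K0 : 0 < K by rewrite ltr_wpDl // addr_ge0 // mulr_ge0 // addr_ge0 ?mulr_ge0.
  have eK : 0 < e / K by rewrite divr_gt0.
  have [d1 d10 D1] := hasjac_second_difference u v WG GJ eK.
  have [d2 d20 D2] := hasjac_second_difference v u WG GJ eK.
  pose t := Num.min d1 d2 / 2.
  have m0 : 0 < Num.min d1 d2 by rewrite lt_min d10.
  have t0 : 0 < t by rewrite divr_gt0.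
  have tm : t < Num.min d1 d2 by rewrite /t; lra.
  have := D1 t; have := D2 t; rewrite t0 /=.
  move: tm; rewrite lt_min => /andP[td1 td2] /(_ td2) b2 /(_ td1) b1.
  rewrite [x + t *: v + t *: u]addrAC in b2.
  have t2 : 0 < t ^+ 2 by rewrite exprn_gt0.
  rewrite -(ler_pM2l t2) -[X in X * `|_|](gtr0_norm t2) -normrM.
  set A := W (x + t *: u + t *: v) in b1 b2.
  have -> : t ^+ 2 * (dot (J *m v) u - dot (J *m u) v) =
    (A - W (x + t *: v) - W (x + t *: u) + W x - t ^+ 2 * dot (J *m u) v)
    - (A - W (x + t *: u) - W (x + t *: v) + W x - t ^+ 2 * dot (J *m v) u) by ring.
  apply: le_trans (ler_normB _ _) _; apply: le_trans (lerD b2 b1) _.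
  rewrite -mulrDr -mulrA ler_pM2l //.
  by rewrite mulrAC ler_pdivrMr // ler_pM2l // /K; lra.
apply/matrixP => i j.
have := sym (delta_mx i 0) (delta_mx j 0).
have E (M : mat) k l : dot (M *m delta_mx k 0) (delta_mx l 0) = M l k.
  rewrite -colE /dot (bigD1 l) //= big1 => [|m ml].
    by rewrite !mxE !eqxx mulr1 addr0.
  by rewrite !mxE (negbTE ml) mulr0.
by rewrite !E mxE => ->.
Qed.

End Frechet.

(** * Calculus of Jacobians, Clarke Jacobians of C1 maps, descent lemma *)

Section Calculus.
Variables (R : realType) (n : nat).
Local Notation vec := 'cV[R]_n.
Local Notation mat := 'M[R]_n.
Implicit Types (F G : vec -> vec) (x : vec) (J : mat).

Lemma hasjac_lipschitz F x J : hasjac F x J ->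
  \forall y \near x, enorm (F y - F x) <= (mnorm J + 1) * enorm (y - x).
Proof.
move=> FJ; apply: filterS (FJ 1 ltr01) => y h.
rewrite -(subrK (J *m (y - x)) (F y - F x)).
apply: le_trans (ler_enormD _ _) _; rewrite mulrDl addrC lerD //.
exact: enorm_mulmx.
Qed.

Lemma hasjac_cvg F x J : hasjac F x J -> F y @[y --> x] --> F x.
Proof.
move=> /hasjac_lipschitz Fl; apply/(@cvg_enorm R n _ (nbhs x)) => e e0.
have J0 : 0 < mnorm J + 1 by rewrite ltr_wpDl ?mnorm_ge0.
apply: filterS2 Fl (near_enorm_lt x (divr_gt0 e0 J0)) => y h.
by rewrite ltr_pdivlMr // mulrC; exact: le_lt_trans.
Qed.

Lemma hasjac_id x : hasjac id x 1%:M.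
Proof.
move=> e e0; apply: (filterE (nbhs_filter x)) => y.
by rewrite mul1mx subrr enorm0 mulr_ge0 ?enorm_ge0 // ltW.
Qed.

Lemma hasjacB F G x J K : hasjac F x J -> hasjac G x K ->
  hasjac (fun y => F y - G y) x (J - K).
Proof.
move=> FJ GK e e0; have e2 : 0 < e / 2 by rewrite divr_gt0.
apply: filterS2 (FJ _ e2) (GK _ e2) => y.
set a := F y - F x - J *m _; set b := G y - G x - K *m _ => ha hb.
have -> : F y - G y - (F x - G x) - (J - K) *m (y - x) = a - b.
  rewrite /a /b mulmxBl; move: (J *m _) (K *m _) => p q.
  by apply/colP => i; rewrite !mxE; ring.
apply: le_trans (ler_enormB _ _) _; lra.
Qed.

Lemma hasjacZ c F x J : hasjac F x J -> hasjac (fun y => c *: F y) x (c *: J).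
Proof.
move=> FJ e e0; have c0 : 0 < `|c| + 1 by rewrite ltr_wpDl.
have e' : 0 < e / (`|c| + 1) by rewrite divr_gt0.
apply: filterS (FJ _ e') => y h.
rewrite -scalemxAl -!scalerBr enormZ.
apply: le_trans (ler_wpM2l _ h) _ => //.
rewrite mulrA ler_wpM2r ?enorm_ge0 // mulrCA ger_pMr // ler_pdivrMr // mul1r.
by rewrite lerDl.
Qed.

Lemma hasjac_comp F G x J K : hasjac F x J -> hasjac G (F x) K ->
  hasjac (fun y => G (F y)) x (K *m J).
Proof.
move=> FJ GK e e0.
have J0 := mnorm_ge0 J; have K0 := mnorm_ge0 K.
(* The errors [e / c * (mnorm J + 1)] from [G] and [mnorm K * (e / c)] from [F] then add up to
   exactly [e]. *)
pose c := mnorm K + mnorm J + 1.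
have c0 : 0 < c by rewrite ltr_wpDl // addr_ge0.
have e' : 0 < e / c by rewrite divr_gt0.
have Gn := hasjac_cvg FJ (GK _ e').
apply: filterS3 (FJ _ e') (hasjac_lipschitz FJ) Gn => y.
set a := F y - F x - _ => ha hl /=.
set b := G (F y) - G (F x) - _ => hb.
have -> : G (F y) - G (F x) - K *m J *m (y - x) = b + K *m a.
  rewrite /b /a [K *m (_ - _ - _)]mulmxBr mulmxA; move: (K *m (_ - _)) (K *m J *m _) => p q.
  by apply/colP => i; rewrite !mxE; ring.
apply: le_trans (ler_enormD _ _) _.
have h1 : enorm (K *m a) <= mnorm K * (e / c * enorm (y - x)).
  by apply: le_trans (enorm_mulmx _ _) _; rewrite ler_wpM2l.
have h2 : enorm b <= e / c * ((mnorm J + 1) * enorm (y - x)).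
  by apply: le_trans hb _; rewrite ler_pM2l.
apply: le_trans (lerD h2 h1) _; rewrite le_eqVlt; apply/orP; left; apply/eqP.
by rewrite /c; field; rewrite gt_eqF.
Qed.

(** Product rule with a factor that is only continuous: as [F x = 0], [F y] is [O(|y - x|)], so
    [(Q y - Q x) F y] is [o(|y - x|)] without any derivative of [Q]. *)
Lemma hasjac_mulmx_root (Q : vec -> mat) F x J : F x = 0 -> hasjac F x J ->
  (forall e : R, 0 < e -> \forall y \near x, mnorm (Q y - Q x) < e) ->
  hasjac (fun y => Q y *m F y) x (Q x *m J).
Proof.
move=> Fx FJ Qc e e0.
have J0 := mnorm_ge0 J; have Q0 := mnorm_ge0 (Q x).
pose c := mnorm (Q x) + mnorm J + 1.
have c0 : 0 < c by rewrite ltr_wpDl // addr_ge0.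
have e' : 0 < e / c by rewrite divr_gt0.
apply: filterS3 (FJ _ e') (hasjac_lipschitz FJ) (Qc _ e') => y.
rewrite Fx mulmx0 !subr0; set a := F y - _ => ha hl hq.
have -> : Q y *m F y - Q x *m J *m (y - x) = (Q y - Q x) *m F y + Q x *m a.
  by rewrite /a mulmxBl (mulmxBr (Q x)) -mulmxA [RHS]addrA subrK.
apply: le_trans (ler_enormD _ _) _.
have h1 : enorm (Q x *m a) <= mnorm (Q x) * (e / c * enorm (y - x)).
  by apply: le_trans (enorm_mulmx _ _) _; rewrite ler_wpM2l.
have h2 : enorm ((Q y - Q x) *m F y) <= e / c * ((mnorm J + 1) * enorm (y - x)).
  apply: le_trans (enorm_mulmx _ _) _.
  by rewrite ler_pM ?mnorm_ge0 ?enorm_ge0 // ltW.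
apply: le_trans (lerD h2 h1) _; rewrite le_eqVlt; apply/orP; left; apply/eqP.
by rewrite /c; field; rewrite gt_eqF.
Qed.

Lemma Ck_nearW k (W : normedModType R) (F : vec -> W) p :
  Ck_near k.+1 F p -> Ck_near k F p.
Proof.
elim: k F => [|k IHk] F [dF pF].
  by apply: filterS dF => y /differentiable_continuous.
by split=> // j; apply: IHk.
Qed.

(** Continuity of the Jacobian is asked at all points near [p], because it is used at the iterates
    and not only at their limit. *)
Definition C1_near F (p : vec) : Prop :=
  (\forall y \near p, hasjac F y (jac F y)) /\
  (\forall y \near p, forall i j, {for y, continuous (fun z => jac F z i j)}).

Lemma Ck_near1_C1 F p : Ck_near 1 F p -> C1_near F p.
Proof.
move=> [dF cF]; split; first by apply: filterS dF => y; exact: hasjac_jac.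
apply: filterS (filter_forall (nbhs_filter p) cF) => y yF i j.
have -> : (fun z => jac F z i j) = (fun M : vec => M i 0) \o (fun z => dpart F z j).
  by apply/funext => z; rewrite mxE.
apply: continuous_comp; first exact: yF.
exact: coord_continuous.
Qed.

Lemma Ck_near2_C1_grad (f : vec -> R) p : Ck_near 2 f p -> C1_near (grad f) p.
Proof.
move=> [df pf].
pose H y : mat := \matrix_(i, j) dpart (fun z => dpart f z i) y j.
have HJ : \forall y \near p, hasjac (grad f) y (H y).
  have := filter_forall (nbhs_filter p) (fun i => (pf i).1).
  apply: filterS => y dy; apply/hasjac_row => i.
  have -> : (fun z => grad f z i 0) = (fun z => dpart f z i).
    by apply/funext => z; rewrite mxE.
  have -> : \col_j H y i j = grad (fun z => dpart f z i) y.
    by apply/colP => j; rewrite !mxE.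
  exact: hasgrad_grad.
have HE : \forall y \near p, jac (grad f) y = H y.
  by apply: filterS HJ => y /hasjac_diff[].
split; first by apply: filterS2 HJ HE => y ? ->.
have cH := filter_forall (nbhs_filter p) (fun i =>
  filter_forall (nbhs_filter p) (pf i).2).
apply: filterS2 cH (nbhs_interior HE) => y cy Ey i j.
have {}Ey : \forall z \near y, jac (grad f) z = H z := Ey.
have Hc : {for y, continuous (fun z => H z i j)}.
  have -> : (fun z => H z i j) = (fun z => dpart (fun z => dpart f z i) z j).
    by apply/funext => z; rewrite mxE.
  exact: cy.
rewrite /prop_for /continuous_at (nbhs_singleton Ey).
apply: cvg_trans Hc; apply: (@near_eq_cvg _ _ (nbhs y) (nbhs_filter y)).
by apply: filterS Ey => z /= ->.
Qed.

(** The sampling points end up where [S] is the singleton of [F]; any local selection there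
    coincides with [F], so the sampled matrices are values of [jac F], which is continuous at [x].
    This is how the free choices of [Q_k] and [P_k] become true Jacobians. *)
Lemma Bsubdiff_jac (S : vec -> set vec) F x M :
  (\forall y \near x, S y = [set F y]) ->
  (forall i j, {for x, continuous (fun z => jac F z i j)}) ->
  Bsubdiff S x M -> M = jac F x.
Proof.
move=> SF cF [ys [Js [ysx [SJ JM]]]].
have JE : \forall k \near \oo, Js k = jac F (ys k).
  have SFk : \forall k \near \oo, \forall z \near ys k, S z = [set F z].
    exact: ysx _ (nbhs_interior SF).
  apply: filterS SFk => k Sk.
  have [F' [SF' [dF' <-]]] := SJ k.
  have FF' : \forall z \near ys k, F' z = F z.
    by apply: filterS2 Sk SF' => z -> /seteqP[+ _] => /(_ (F z) erefl) ->.
  by have [_ ->] := hasjac_diff (hasjac_near FF' (hasjac_jac dF')).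
apply/matrixP => i j.
have c1 : (fun k => Js k i j) @ \oo --> M i j.
  have cM : (fun N : mat => N i j) @ nbhs M --> M i j by exact: coord_continuous.
  exact: (cvg_comp Js (fun N : mat => N i j) JM cM).
have c2 : (fun k => Js k i j) @ \oo --> jac F x i j.
  have := cvg_comp ys (fun z => jac F z i j) ysx (cF i j); apply: cvg_trans.
  by apply: near_eq_cvg; apply: filterS JE => k ->.
exact: cvg_unique c1 c2.
Qed.

Lemma clarke_jac_jac (S : vec -> set vec) F x M :
  (\forall y \near x, S y = [set F y]) ->
  (forall i j, {for x, continuous (fun z => jac F z i j)}) ->
  clarke_jac S x M -> M = jac F x.
Proof.
move=> SF cF [m [lam [Ms [_ [lam1 [MsB ->]]]]]].
under eq_bigr do rewrite (Bsubdiff_jac SF cF (MsB _)).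
by rewrite -scaler_suml lam1 scale1r.
Qed.

(** The mean value theorem is applied to [f - L/2 |. - x|^2], in place of the usual integral: at the
    intermediate [t] the quadratic contributes [- L t |h|^2], which matches the Lipschitz bound on
    the change of gradient from [x] to [x + t h]. *)
Lemma descent_lemma (f : vec -> R) (L : R) : (forall y, differentiable f y) ->
  (forall y z, enorm (grad f y - grad f z) <= L * enorm (y - z)) ->
  forall x u, f u <= f x + dot (grad f x) (u - x) + L / 2 * enorm (u - x) ^+ 2.
Proof.
move=> df Lf x u; pose h := u - x.
have [t _|t /andP[t0 t1]] := @MVT_line R n
    (fun y => f y - L / 2 * enorm (y - x) ^+ 2) x h
    (fun t => grad f (x + t *: h) - (2 * (L / 2)) *: (x + t *: h - x)).
  apply: hasgradB; [exact: hasgrad_grad|exact: hasgrad_sqr_dist].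
have xK (a : vec) : x + a - x = a by rewrite addrC addKr.
rewrite !xK subrr enorm0 (_ : x + h = u); last by rewrite addrC subrK.
rewrite -/h dotDl dotNl scalerA dotZl -sqr_enorm.
have := Lf (x + t *: h) x; rewrite xK enormZ gtr0_norm // => Lt.
have := dot_le_enorm (grad f (x + t *: h) - grad f x) h; rewrite dotDl dotNl.
have := ler_wpM2r (enorm_ge0 h) Lt.
have key (p a b c fu fx : R) : p * c <= L * (t * c) * c -> a - b <= p * c ->
    fu - L / 2 * c ^+ 2 - (fx - L / 2 * 0 ^+ 2) = a - 2 * (L / 2) * t * c ^+ 2 ->
    fu <= fx + b + L / 2 * c ^+ 2.
  clear; lra.
exact: key.
Qed.

Lemma superlinear_intro (u : nat -> vec) (l : vec) : u @ \oo --> l ->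
  (forall e : R, 0 < e ->
    \forall k \near \oo, enorm (u k.+1 - l) <= e * enorm (u k - l)) ->
  superlinear u l.
Proof.
move=> ul us; split=> //.
(* Where [u k = l] the quotient is 0, since [0^-1 = 0]; the hypothesis with [e = 1] then forces
   [u k.+1 = l]. *)
exists (fun k => enorm (u k.+1 - l) / enorm (u k - l)); split.
  apply/cvgr0Pnorm_le => e e0; apply: filterS (us e e0) => k h.
  rewrite ger0_norm ?divr_ge0 ?enorm_ge0 //.
  have [->|u0] := eqVneq (enorm (u k - l)) 0; first by rewrite invr0 mulr0 ltW.
  by rewrite ler_pdivrMr // lt_def u0 enorm_ge0.
apply: filterS (us 1 ltr01) => k h.
have [E|u0] := eqVneq (enorm (u k - l)) 0; last by rewrite divfK.
by move: h; rewrite E !mulr0.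
Qed.

End Calculus.

(** * The forward-backward envelope: attainment, bounds, gradient *)

Section ForwardBackwardEnvelope.
Variables (R : realType) (n : nat).
Local Notation vec := 'cV[R]_n.
Local Notation mat := 'M[R]_n.
Variables (gam : R) (f : vec -> R) (g : vec -> \bar R).
Hypotheses (gam0 : 0 < gam) (g_proper : proper_fun g).

(** The finite part of the forward-backward model; [g] is kept apart so that infinite values stay in
    one summand. *)
Definition fb_model (x u : vec) : R :=
  f x + dot (grad f x) (u - x) + enorm (u - x) ^+ 2 / (2 * gam).

(** Completing the square: the prox objective and the model differ by a quantity independent of [u],
    hence have the same minimizers. *)
Lemma sqr_enorm_forward (x u : vec) :
  enorm (u - (x - gam *: grad f x)) ^+ 2 / (2 * gam) =
  fb_model x u + (gam / 2 * enorm (grad f x) ^+ 2 - f x).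
Proof.
rewrite opprB addrCA addrC /fb_model; move: (u - x) (grad f x) (f x) => p q fx.
rewrite !sqr_enorm !dotE_lin (dotC q p); field; exact: lt0r_neq0.
Qed.

Lemma Tfb_fin_num x z : Tfb gam f g x z -> g z \is a fin_num.
Proof.
move=> Tz; have [gN [w gw]] := g_proper.
rewrite fin_numE gN /=; apply/eqP => gz.
have := Tz w; rewrite gz addye // leye_eq.
by have := gN w; case: (g w) gw.
Qed.

Lemma Tfb_min x z u : Tfb gam f g x z ->
  ((fb_model x z)%:E + g z <= (fb_model x u)%:E + g u)%E.
Proof.
move=> /(_ u); rewrite !sqr_enorm_forward.
rewrite (EFinD (fb_model x z)) (EFinD (fb_model x u)) !addeA leeD2rE //.
by rewrite addeC (addeC (g u)).
Qed.

Lemma fbe_Tfb x z : Tfb gam f g x z ->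
  fbe gam f g x = (fb_model x z + fine (g z))%:E.
Proof.
move=> Tz; rewrite EFinD fineK ?(Tfb_fin_num Tz) //.
have E u : ((f x + dot (grad f x) (u - x))%:E + g u +
    (enorm (u - x) ^+ 2 / (2 * gam))%:E = (fb_model x u)%:E + g u)%E.
  by rewrite addeAC -EFinD.
apply/eqP; rewrite eq_le; apply/andP; split.
  by apply: ereal_inf_lbound; exists z; rewrite ?E.
by apply/ereal_infP => _ [u _ <-]; rewrite E Tfb_min.
Qed.

Local Notation W x := (fine (fbe gam f g x)).

Lemma fbe_model x z : Tfb gam f g x z -> W x = fb_model x z + fine (g z).
Proof. by move=> /fbe_Tfb ->. Qed.

Lemma fbe_fineK x z : Tfb gam f g x z -> fbe gam f g x = (W x)%:E.
Proof. by move=> Tz; rewrite (fbe_model Tz) (fbe_Tfb Tz). Qed.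

Lemma fbe_le_model x y z u : Tfb gam f g x z -> Tfb gam f g y u ->
  W x <= fb_model x u + fine (g u).
Proof.
move=> Tz Tu; rewrite (fbe_model Tz) -lee_fin !EFinD !fineK ?(Tfb_fin_num Tz) //.
  exact: Tfb_min.
exact: Tfb_fin_num Tu.
Qed.

Lemma fbe_ge (Lf : R) : (forall y, differentiable f y) ->
  (forall y z, enorm (grad f y - grad f z) <= Lf * enorm (y - z)) ->
  forall x z, Tfb gam f g x z ->
  f z + fine (g z) + (1 - gam * Lf) / (2 * gam) * enorm (z - x) ^+ 2 <= W x.
Proof.
move=> df Lfh x z Tz; rewrite (fbe_model Tz) /fb_model.
have := descent_lemma df Lfh x z.
have -> : (1 - gam * Lf) / (2 * gam) = (2 * gam)^-1 - Lf / 2.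
  by field; exact: lt0r_neq0.
move: (f z) (f x) (dot _ _) (enorm _) (fine _) => a b c e h.
have -> : e ^+ 2 / (2 * gam) = (2 * gam)^-1 * e ^+ 2 by rewrite mulrC.
move: (_ ^-1) => q; clear; lra.
Qed.

(** Exact expansion of the change of the model when its base point moves from [x] to [y]. The
    subtracted term is the differential in the base point at [u = w]; each summand on the right is
    [o(|y - x|)] as [y] tends to [x] and [u] to [w]. *)
Lemma fb_modelB (H : mat) (x y u w : vec) :
  fb_model y u - fb_model x u - dot (H *m (y - x) - gam^-1 *: (y - x)) (w - x) =
  dot (H *m (y - x) - gam^-1 *: (y - x)) (u - w)
  + (f y - f x - dot (grad f x) (y - x))
  + dot (grad f y - grad f x - H *m (y - x)) (u - x)
  - dot (grad f y - grad f x) (y - x) + (2 * gam)^-1 * enorm (y - x) ^+ 2.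
Proof.
rewrite /fb_model.
have -> : u - y = (u - x) - (y - x) by rewrite opprB addrA subrK.
have -> : w - x = (u - x) - (u - w) by rewrite opprB [RHS]addrC subrKA.
move: (u - x) (u - w) (y - x) (H *m _) (grad f y) (grad f x) => p q d h gy gx.
rewrite !sqr_enorm !dotE_lin (dotC d p); field; exact: lt0r_neq0.
Qed.

(** Envelope argument: testing each minimizer in the other model traps [W y - W x] between the
    increments of [fb_model] at [u = T y] (below) and at [u = T x] (above). Both have the same
    linear part because [T y] tends to [T x], so no derivative of [T] enters. *)
Lemma hasgrad_fbe (T : vec -> vec) (x : vec) (H : mat) :
  (\forall y \near x, Tfb gam f g y (T y)) -> differentiable f x ->
  hasjac (grad f) x H -> T y @[y --> x] --> T x ->
  hasgrad (fun y => W y) x ((1%:M - gam *: H)^T *m (gam^-1 *: (x - T x))).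
Proof.
move=> TfbT df gH cT e e0.
have gi : 0 < gam^-1 by rewrite invr_gt0.
have m0 := mnorm_ge0 H; have k0 := enorm_ge0 (T x - x).
(* [C] dominates the sum of the coefficients of [h * enorm (y - x)] in the bounds for the five terms
   of [fb_modelB]. *)
pose C := 2 * mnorm H + 2 * gam^-1 + enorm (T x - x) + 4.
have C0 : 0 < C by rewrite /C; lra.
pose h := Num.min 1 (e / C).
have h0 : 0 < h by rewrite lt_min ltr01 divr_gt0.
have h1 : h <= 1 by rewrite ge_min lexx.
have hC : h * C <= e by rewrite -ler_pdivlMr // ge_min lexx orbT.
have T1 : \forall y \near x, enorm (T y - T x) < h.
  exact: (cT _ (near_enorm_lt (T x) h0)).
have Tx := nbhs_singleton TfbT.
pose L (y : vec) := dot (H *m (y - x) - gam^-1 *: (y - x)) (T x - x).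
have est y u : `|f y - f x - dot (grad f x) (y - x)| <= h * enorm (y - x) ->
    enorm (grad f y - grad f x - H *m (y - x)) <= h * enorm (y - x) ->
    enorm (y - x) < h -> enorm (u - T x) < h ->
    `|fb_model y u - fb_model x u - L y| <= e * enorm (y - x).
  rewrite /L fb_modelB; set D := grad f y - grad f x => h2 h3 h4 h5.
  have d0 := enorm_ge0 (y - x).
  have t1 : enorm (H *m (y - x) - gam^-1 *: (y - x))
      <= (mnorm H + gam^-1) * enorm (y - x).
    apply: le_trans (ler_enormB _ _) _; rewrite mulrDl lerD ?enorm_mulmx //.
    by rewrite enormZ gtr0_norm.
  have t2 : enorm D <= (mnorm H + 1) * enorm (y - x).
    rewrite -(subrK (H *m (y - x)) D); apply: le_trans (ler_enormD _ _) _.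
    rewrite addrC mulrDl lerD ?enorm_mulmx //; apply: le_trans h3 _.
    by rewrite ler_wpM2r.
  have t3 : enorm (u - x) <= enorm (T x - x) + 1.
    apply: le_trans (ler_enorm_dist (T x) _ _) _; rewrite addrC lerD //.
    by apply: ltW; exact: lt_le_trans h5 h1.
  have s1 := abs_dot_le (H *m (y - x) - gam^-1 *: (y - x)) (u - T x).
  have s2 := abs_dot_le (D - H *m (y - x)) (u - x).
  have s3 := abs_dot_le D (y - x).
  have r1 := ler_pM (enorm_ge0 _) (enorm_ge0 _) t1 (ltW h5).
  have r2 := ler_pM (enorm_ge0 _) (enorm_ge0 _) h3 t3.
  have r3 := ler_pM (enorm_ge0 _) (enorm_ge0 _) t2 (ltW h4).
  have r4 : (2 * gam)^-1 * enorm (y - x) ^+ 2 <= gam^-1 * (h * enorm (y - x)).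
    rewrite invfM expr2 -mulrA; have : enorm (y - x) * enorm (y - x) <= h * enorm (y - x).
      by rewrite ler_wpM2r // ltW.
    have := mulr_ge0 d0 d0; move: (enorm (y - x) * enorm _) (h * _) (gam^-1) gi.
    by clear => q s t t0 q0 qs; have := mulr_ge0 (ltW t0) q0; nra.
  have r5 : 0 <= (2 * gam)^-1 * enorm (y - x) ^+ 2.
    by rewrite mulr_ge0 ?sqr_ge0 // invr_ge0 mulr_ge0 // ltW.
  apply: (@le_trans _ _ (h * C * enorm (y - x))); last by rewrite ler_wpM2r.
  have hd := mulr_ge0 (ltW h0) d0.
  rewrite /C; move: r1 r2 r3 r4 r5 s1 s2 s3 h2 hd; rewrite !ler_norml.
  move: (dot _ (u - T x)) (dot _ (u - x)) (dot D _) ((2 * gam)^-1 * _).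
  move: (f y - _ - _) (enorm (H *m _ - _) * _) (enorm (D - _) * _) (enorm D * _).
  move: (enorm (y - x)) (enorm (T x - x)) (mnorm H) (gam^-1) (h).
  clear; move=> d k m gi h a a1 a2 a3 b1 b2 b3 b4 r1 r2 r3 r4 r5.
  by move=> /andP[? ?] /andP[? ?] /andP[? ?] /andP[? ?] hd; apply/andP; split; lra.
have LE y : L y = dot ((1%:M - gam *: H)^T *m (gam^-1 *: (x - T x))) (y - x).
  rewrite dot_trmx trmxK /L -(opprB x (T x)) dotNr mulmxBl mul1mx -scalemxAl.
  move: (x - T x) (y - x) (H *m _) => p q r.
  rewrite !dotE_lin (dotC p q) (dotC p r); field; exact: lt0r_neq0.
near=> y; rewrite -LE.
have Ty : Tfb gam f g y (T y) by near: y.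
have f1 : `|f y - f x - dot (grad f x) (y - x)| <= h * enorm (y - x).
  by near: y; exact: (hasgrad_grad df).
have g1 : enorm (grad f y - grad f x - H *m (y - x)) <= h * enorm (y - x).
  by near: y; exact: gH.
have yx : enorm (y - x) < h by near: y; exact: near_enorm_lt.
have Tyx : enorm (T y - T x) < h by near: y.
have TT : enorm (T x - T x) < h by rewrite subrr enorm0.
have := est _ _ f1 g1 yx TT; have := est _ _ f1 g1 yx Tyx.
have := fbe_le_model Tx Ty; have := fbe_le_model Ty Tx.
rewrite /= (fbe_model Tx) (fbe_model Ty).
rewrite !ler_norml => u1 u2 /andP[u3 u4] /andP[u5 u6]; apply/andP; split.
  move: u2 u3; clear; lra.
move: u1 u6; clear; lra.
Unshelve. all: by end_near. Qed.

End ForwardBackwardEnvelope.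

(** * Second-order bounds at a critical point *)

Section SecondOrder.
Variables (R : realType) (n : nat).
Local Notation vec := 'cV[R]_n.
Local Notation mat := 'M[R]_n.
Variables (W : vec -> R) (G : vec -> vec) (x0 : vec) (B : mat).
Hypotheses (WG : \forall y \near x0, hasgrad W y (G y))
  (GB : hasjac G x0 B) (G0 : G x0 = 0).

(** The mean value theorem gives the gradient at [x0 + s h], which is [s B h] up to [e |h|]. The
    factor [s] depends on [h]; only [0 < s < 1] is used afterwards. *)
Lemma quadratic_expansion_segment (e : R) : 0 < e ->
  exists2 d : R, 0 < d & forall h, enorm h < d ->
    exists2 s : R, 0 < s < 1 &
      `|W (x0 + h) - W x0 - s * dot (B *m h) h| <= e * enorm h ^+ 2.
Proof.
move=> e0; have /nbhs_enorm[d1 d10 WGd] := WG.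
have /nbhs_enorm[d2 d20 GBd] := GB e0.
exists (Num.min d1 d2); first by rewrite lt_min d10.
move=> h; rewrite lt_min => /andP[h1 h2].
have xK (a : vec) : x0 + a - x0 = a by rewrite addrC addKr.
have sh (s : R) : 0 <= s <= 1 -> enorm (s *: h) <= enorm h.
  by move=> /andP[s0 s1]; rewrite enormZ ger0_norm // ler_piMl ?enorm_ge0.
have [s s01|s s01 E] := @MVT_line _ _ W x0 h (fun s => G (x0 + s *: h)).
  by apply: WGd; rewrite xK; apply: le_lt_trans h1; exact: sh.
exists s => //; have s01' : 0 <= s <= 1 by case/andP: s01 => *; rewrite !ltW.
have := GBd (x0 + s *: h); rewrite xK G0 subr0 => /(_ (le_lt_trans (sh _ s01') h2)).
rewrite E -scalemxAr -dotZl -dotNl -dotDl => b.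
apply: le_trans (abs_dot_le _ _) _; rewrite expr2 mulrA ler_wpM2r ?enorm_ge0 //.
by apply: le_trans b _; rewrite ler_pM2l // sh.
Qed.

Lemma quadratic_upper_bound :
  \forall x \near x0, `|W x - W x0| <= (mnorm B + 1) * enorm (x - x0) ^+ 2.
Proof.
have [d d0 dW] := quadratic_expansion_segment ltr01.
apply/nbhs_enorm; exists d => // x /dW[s /andP[s0 s1]].
rewrite [x0 + _]addrC subrK => b.
have c : `|s * dot (B *m (x - x0)) (x - x0)| <= mnorm B * enorm (x - x0) ^+ 2.
  rewrite normrM gtr0_norm //; apply: le_trans (_ : `|dot (B *m (x - x0)) (x - x0)| <= _).
    by rewrite ler_piMl // ltW.
  apply: le_trans (abs_dot_le _ _) _; rewrite expr2 mulrA ler_wpM2r ?enorm_ge0 //.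
  exact: enorm_mulmx.
rewrite -(subrK (s * dot (B *m (x - x0)) (x - x0)) (W x - W x0)).
by apply: le_trans (ler_normD _ _) _; rewrite mulrDl addrC lerD.
Qed.

(** Growth is tested at [t h] for a small [t]; half of [c] pays for the remainder, which leaves
    [c / 2 |h|^2 <= s <B h, h>]. The right side being nonnegative, [s < 1] allows [s] to be
    dropped. *)
Lemma quadratic_growth_coercive (c : R) : 0 < c ->
  (\forall x \near x0, W x0 + c * enorm (x - x0) ^+ 2 <= W x) ->
  forall h, c / 2 * enorm h ^+ 2 <= dot (B *m h) h.
Proof.
move=> c0 /nbhs_enorm[d1 d10 Wc] h.
have [d2 d20 Wd] := quadratic_expansion_segment (divr_gt0 c0 (ltr0Sn R 1)).
have h0 := enorm_ge0 h.
have hp : 0 < enorm h + 1 by rewrite ltr_wpDl.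
pose m := Num.min d1 d2.
have m0 : 0 < m by rewrite lt_min d10.
pose t := m / (enorm h + 1).
have t0 : 0 < t by rewrite divr_gt0.
have thm : enorm (t *: h) < m.
  by rewrite enormZ gtr0_norm // /t mulrAC ltr_pdivrMr // ltr_pM2l // ltrDl.
move: thm; rewrite lt_min => /andP[th1 th2].
have [s /andP[s0 s1]] := Wd _ th2.
have xK (a : vec) : x0 + a - x0 = a by rewrite addrC addKr.
have := Wc (x0 + t *: h); rewrite xK => /(_ th1).
rewrite enormZ gtr0_norm // -scalemxAr dotZl dotZr exprMn.
have t2 : 0 < t ^+ 2 by rewrite exprn_gt0.
have q0 : 0 <= enorm h ^+ 2 by rewrite sqr_ge0.
rewrite ler_norml => a /andP[_ b].
rewrite -(ler_pM2l t2).
move: a b t2 q0; move: (W _) (W _) (dot _ _) (enorm h ^+ 2) => w1 w0 D q.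
have -> : t * (t * D) = t ^+ 2 * D by ring.
move: (t ^+ 2) => T a b T0 q0.
have TD : c / 2 * (T * q) <= s * (T * D) by lra.
have cTq : 0 <= c / 2 * (T * q) by rewrite !mulr_ge0 ?divr_ge0 // ltW.
have TD0 : 0 <= T * D by rewrite -(pmulr_rge0 _ s0); exact: le_trans TD.
by rewrite mulrCA; apply: le_trans TD _; rewrite ler_piMl // ltW.
Qed.

End SecondOrder.

(** * Entrywise limits of matrices and the eigenvalue test *)

Section EntrywiseConvergence.
Variables (R : realType) (n : nat) (T : Type) (Fl : set_system T).
Context {FF : Filter Fl}.

Lemma mulmx_cvg_entry (A B : T -> 'M[R]_n) (A0 B0 : 'M[R]_n) :
  (forall i j, (fun t => A t i j) @ Fl --> A0 i j) ->
  (forall i j, (fun t => B t i j) @ Fl --> B0 i j) ->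
  forall i j, (fun t => (A t *m B t) i j) @ Fl --> (A0 *m B0) i j.
Proof.
move=> cA cB i j; rewrite [X in _ --> X]mxE.
under eq_fun do rewrite mxE.
by apply: cvg_big => [|k _]; [exact: add_continuous|exact: cvgM].
Qed.

Lemma Bmat_cvg_entry (gam : R) (Q P : T -> 'M[R]_n) (Q0 P0 : 'M[R]_n) :
  (forall i j, (fun t => Q t i j) @ Fl --> Q0 i j) ->
  (forall i j, (fun t => P t i j) @ Fl --> P0 i j) ->
  forall i j, (fun t => Bmat gam (Q t) (P t) i j) @ Fl --> Bmat gam Q0 P0 i j.
Proof.
move=> cQ cP i j.
have c1 k l : (fun t => (1%:M - P t *m Q t) k l) @ Fl --> (1%:M - P0 *m Q0) k l.
  rewrite [X in _ --> X]mxE [X in _ + X]mxE.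
  under eq_fun do rewrite mxE [X in _ + X]mxE.
  by apply: cvgB; [exact: cvg_cst|exact: mulmx_cvg_entry].
rewrite [X in _ --> X]mxE.
under eq_fun do rewrite mxE.
by apply: cvgMr; exact: mulmx_cvg_entry.
Qed.

End EntrywiseConvergence.

Lemma lambda_min_nonneg_coercive (R : realType) (n : nat) (B : 'M[R]_n) :
  (forall h, 0 <= dot (B *m h) h) -> lambda_min_nonneg B.
Proof.
move=> Bpos a /eigenvalueP[v vB v0].
(* [eigenvalue] refers to row vectors, [v *m B = a *: v]; the quadratic form at [v^T] is then
   [a |v|^2], whether or not [B] is symmetric. *)
have := Bpos v^T; rewrite dotC dotE trmxK mulmxA vB -scalemxAl mxE.
have -> : (v *m v^T) 0 0 = dot v^T v^T by rewrite dotE trmxK.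
rewrite pmulr_lge0 // lt_def dot_ge0 andbT -sqr_enorm sqrf_eq0.
apply: contra v0 => /eqP/enorm_eq0 vT.
by rewrite -(trmxK v) vT trmx0.
Qed.

(** * Smooth branches near the limit point, Hessian and coercivity of the envelope *)

Section LocalStructure.
Variables (R : realType) (n : nat).
Local Notation vec := 'cV[R]_n.
Local Notation mat := 'M[R]_n.
Variables (gam : R) (f : vec -> R) (g : vec -> \bar R) (F : vec -> vec) (xs : vec).

(** [F] stands for the C1 branch of the prox near [fwd xs]. This and the next four definitions are
    the forward step and what [T], [R] and the Clarke elements [Q], [P] reduce to near [xs]. *)
Definition fwd (y : vec) : vec := y - gam *: grad f y.
Definition Tmap (y : vec) : vec := F (fwd y).
Definition Rmap (y : vec) : vec := gam^-1 *: (y - Tmap y).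
Definition Qmat (y : vec) : mat := 1%:M - gam *: jac (grad f) y.
Definition Pmat (y : vec) : mat := jac F (fwd y).

Hypotheses (gam0 : 0 < gam) (g_proper : proper_fun g)
  (df : forall y, differentiable f y) (f_C1 : C1_near (grad f) xs)
  (proxF : \forall y \near fwd xs, prox gam g y = [set F y])
  (F_C1 : C1_near F (fwd xs)).

Local Notation W y := (fine (fbe gam f g y)).

Lemma fwd_hasjac : \forall y \near xs, hasjac fwd y (Qmat y).
Proof.
by apply: filterS f_C1.1 => y h; apply: hasjacB (hasjac_id _) (hasjacZ _ h).
Qed.

Lemma fwd_cvg : fwd y @[y --> xs] --> fwd xs.
Proof. exact: hasjac_cvg (nbhs_singleton fwd_hasjac). Qed.

Lemma near_fwd (U : set vec) : (\forall z \near fwd xs, U z) ->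
  \forall y \near xs, U (fwd y).
Proof. by move=> /fwd_cvg. Qed.

Lemma Tfb_Tmap : \forall y \near xs, Tfb gam f g y = [set Tmap y].
Proof. exact: near_fwd proxF. Qed.

Lemma Tmap_hasjac : \forall y \near xs, hasjac Tmap y (Pmat y *m Qmat y).
Proof.
apply: filterS2 fwd_hasjac (near_fwd F_C1.1) => y h1 h2.
exact: (@hasjac_comp R n fwd F) h1 h2.
Qed.

Lemma Rmap_hasjac :
  \forall y \near xs, hasjac Rmap y (gam^-1 *: (1%:M - Pmat y *m Qmat y)).
Proof.
apply: filterS Tmap_hasjac => y h.
exact: (hasjacZ _ (hasjacB (hasjac_id _) h)).
Qed.

Lemma fbe_hasgrad :
  \forall y \near xs, hasgrad (fun z => W z) y ((Qmat y)^T *m Rmap y).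
Proof.
(* The gradient is computed at every [y] near [xs], so the identity for [Tfb] must hold around each
   such [y]. *)
apply: filterS3 (nbhs_interior Tfb_Tmap) f_C1.1 Tmap_hasjac => y Ty fy Tj.
apply: hasgrad_fbe => //; last exact: hasjac_cvg Tj.
have {}Ty : \forall z \near y, Tfb gam f g z = [set Tmap z] := Ty.
by apply: filterS Ty => z ->.
Qed.

(** Used at [xs] to give the gradient [Q^T R] of the envelope and the vector [Q R] of the
    Dennis-More condition the same Jacobian there. *)
Lemma Qmat_sym : (Qmat xs)^T = Qmat xs.
Proof.
rewrite /Qmat linearB linearZ /= trmx1 (@hasjac_grad_sym _ _ f (grad f) xs) //.
  by apply: filterE => y; exact: hasgrad_grad.
exact: nbhs_singleton f_C1.1.
Qed.

Lemma Qmat_cvg_entry i j : (fun y => Qmat y i j) @ nbhs xs --> Qmat xs i j.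
Proof.
rewrite [X in _ --> X]mxE [X in _ + X]mxE [X in _ - X]mxE.
under eq_fun do rewrite mxE [X in _ + X]mxE [X in _ - X]mxE.
apply: cvgB; first exact: cvg_cst.
by apply: cvgMr; exact: (nbhs_singleton f_C1.2).
Qed.

Lemma Pmat_cvg_entry i j : (fun y => Pmat y i j) @ nbhs xs --> Pmat xs i j.
Proof.
have cF : (fun z => jac F z i j) @ nbhs (fwd xs) --> jac F (fwd xs) i j.
  exact: (nbhs_singleton F_C1.2).
exact: (cvg_comp fwd (fun z => jac F z i j) fwd_cvg cF).
Qed.

Lemma clarke_forward : \forall y \near xs, forall M Q,
  clarke_jac (fun z => [set grad f z]) y M -> Q = 1%:M - gam *: M -> Q = Qmat y.
Proof.
apply: filterS f_C1.2 => y cy M Q My ->; rewrite /Qmat.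
rewrite -(@clarke_jac_jac _ _ (fun z => [set grad f z]) (grad f) y M) //.
exact: filterE.
Qed.

Lemma clarke_prox : \forall y \near xs, forall P,
  clarke_jac (prox gam g) (fwd y) P -> P = Pmat y.
Proof.
apply: filterS2 (near_fwd (nbhs_interior proxF)) (near_fwd F_C1.2) => y py cy P.
exact: clarke_jac_jac.
Qed.

Hypothesis Tfix : Tmap xs = xs.

Lemma Rmap_root : Rmap xs = 0.
Proof. by rewrite /Rmap Tfix subrr scaler0. Qed.

Definition Bstar : mat := Bmat gam (Qmat xs) (Pmat xs).

Lemma BstarE : Bstar = Qmat xs *m (gam^-1 *: (1%:M - Pmat xs *m Qmat xs)).
Proof. by rewrite /Bstar /Bmat scalemxAr. Qed.

Lemma QR_hasjac : hasjac (fun y => Qmat y *m Rmap y) xs Bstar.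
Proof.
rewrite BstarE; apply: hasjac_mulmx_root (nbhs_singleton Rmap_hasjac) _.
  exact: Rmap_root.
by move=> e e0; apply: (@mnorm_cvg R n _ (nbhs xs) _ Qmat) => // i j; exact: Qmat_cvg_entry.
Qed.

Lemma fbe_grad_hasjac : hasjac (fun y => (Qmat y)^T *m Rmap y) xs Bstar.
Proof.
rewrite BstarE -[X in X *m _]Qmat_sym.
apply: (@hasjac_mulmx_root _ _ (fun y => (Qmat y)^T)) (nbhs_singleton Rmap_hasjac) _.
  exact: Rmap_root.
move=> e e0; apply: (@mnorm_cvg R n _ (nbhs xs) _ (fun y => (Qmat y)^T)) => // i j.
rewrite [X in _ --> X]mxE; under eq_fun do rewrite mxE; exact: Qmat_cvg_entry.
Qed.

Lemma hess_fbe : hess (fun y => W y) xs = Bstar.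
Proof.
(* [hess] differentiates the [j]-th partial in direction [i], which is the transposed Jacobian of
   the gradient; symmetry removes the transpose. *)
rewrite -(hasjac_grad_sym fbe_hasgrad fbe_grad_hasjac).
apply/matrixP => i j; rewrite [in RHS]mxE [LHS]mxE.
have /hasjac_row /(_ j) hj := fbe_grad_hasjac.
have E : \forall y \near xs, ((Qmat y)^T *m Rmap y) j 0 = dpart (fun z => W z) y j.
  by apply: filterS fbe_hasgrad => y /hasgrad_diff[_ <-]; rewrite mxE.
have [_ /colP/(_ i) h] := hasgrad_diff (hasgrad_near E hj).
by rewrite [LHS]mxE [RHS]mxE in h.
Qed.

Lemma Tfb_fix : Tfb gam f g xs xs.
Proof. by rewrite (nbhs_singleton Tfb_Tmap) /= Tfix. Qed.

Lemma fbe_fix : W xs = f xs + fine (g xs).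
Proof.
rewrite (fbe_model gam0 g_proper Tfb_fix) /fb_model subrr dot0r enorm0.
by rewrite expr0n mul0r !addr0.
Qed.

(** Strong minimality at [z] is inserted in the descent bound. Both squares are kept: [fbe_growth]
    trades them for [|y - xs|^2], whereas acceptance of the unit step spends the second on
    [sigma |r k|^2]. Nearness is asked of [z], which along the run is [xbar k]. *)
Lemma fbe_forward_growth (Lf : R) :
  (forall y z, enorm (grad f y - grad f z) <= Lf * enorm (y - z)) ->
  strong_local_min (fun y => (f y)%:E + g y)%E xs ->
  exists2 c : R, 0 < c & exists2 e : R, 0 < e &
    forall y z, Tfb gam f g y z -> enorm (z - xs) < e ->
      W xs + c * enorm (z - xs) ^+ 2
        + (1 - gam * Lf) / (2 * gam) * enorm (z - y) ^+ 2 <= W y.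
Proof.
move=> fL [c [e [c0 [e0 cmin]]]]; exists c => //; exists e => // y z Tz ze.
apply: le_trans (fbe_ge gam0 g_proper df fL Tz); rewrite lerD2r fbe_fix.
have := cmin z ze.
rewrite -(fineK (Tfb_fin_num g_proper Tz)).
by rewrite -(fineK (Tfb_fin_num g_proper Tfb_fix)) -!EFinD lee_fin.
Qed.

Lemma fbe_growth (Lf : R) : gam * Lf < 1 ->
  (forall y z, enorm (grad f y - grad f z) <= Lf * enorm (y - z)) ->
  strong_local_min (fun y => (f y)%:E + g y)%E xs ->
  exists2 c : R, 0 < c & \forall y \near xs, W xs + c * enorm (y - xs) ^+ 2 <= W y.
Proof.
move=> gL fL xs_min; have [c c0 [e e0 grow]] := fbe_forward_growth fL xs_min.
pose a := (1 - gam * Lf) / (2 * gam).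
have a0 : 0 < a by rewrite divr_gt0 ?subr_gt0 // mulr_gt0.
pose b := Num.min c a; have b0 : 0 < b by rewrite lt_min c0.
have [bc ba] : b <= c /\ b <= a by split; rewrite ge_min lexx ?orbT.
(* The half comes from [|y - xs| <= |T y - xs| + |T y - y|] and [(q + r)^2 <= 2 (q^2 + r^2)]. *)
exists (b / 2); first exact: divr_gt0.
have Tc : Tmap y @[y --> xs] --> Tmap xs := hasjac_cvg (nbhs_singleton Tmap_hasjac).
have Te : \forall y \near xs, enorm (Tmap y - xs) < e.
  by move: Tc; rewrite Tfix => Tc; exact: (Tc _ (near_enorm_lt _ e0)).
apply: filterS2 Tfb_Tmap Te => y Ty Tye.
have Ty' : Tfb gam f g y (Tmap y) by rewrite Ty.
apply: le_trans (grow _ _ Ty' Tye); rewrite -/a -addrA lerD2l.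
have tri : enorm (y - xs) <= enorm (Tmap y - xs) + enorm (Tmap y - y).
  by have := ler_enorm_dist (Tmap y) y xs; rewrite (enormBC y (Tmap y)) [leRHS]addrC.
move: tri (enorm_ge0 (y - xs)) bc ba.
move: (enorm (y - xs)) (enorm (Tmap y - xs)) (enorm (Tmap y - y)) b0 => p q r; move: b (a) (c).
clear => b a c b0 pqr p0 bc ba.
have h1 : b * q ^+ 2 <= c * q ^+ 2 by rewrite ler_wpM2r // sqr_ge0.
have h2 : b * r ^+ 2 <= a * r ^+ 2 by rewrite ler_wpM2r // sqr_ge0.
apply: le_trans (lerD h1 h2); rewrite -mulrDr -mulrA ler_pM2l //.
have : p ^+ 2 <= (q + r) ^+ 2 by rewrite ler_pXn2r ?nnegrE // (le_trans p0).
have := sqr_ge0 (q - r); lra.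
Qed.

Lemma Bstar_coercive (Lf : R) : gam * Lf < 1 ->
  (forall y z, enorm (grad f y - grad f z) <= Lf * enorm (y - z)) ->
  strong_local_min (fun y => (f y)%:E + g y)%E xs ->
  exists2 m : R, 0 < m & forall h, m * enorm h ^+ 2 <= dot (Bstar *m h) h.
Proof.
move=> gL fL xs_min; have [c c0 grow] := fbe_growth gL fL xs_min.
exists (c / 2); first exact: divr_gt0.
apply: (quadratic_growth_coercive fbe_hasgrad fbe_grad_hasjac _ c0 grow).
by rewrite Rmap_root mulmx0.
Qed.

Lemma Bmat_coercive (m : R) : 0 < m ->
  (forall h, m * enorm h ^+ 2 <= dot (Bstar *m h) h) ->
  \forall y \near xs, forall h,
    m / 2 * enorm h ^+ 2 <= dot (Bmat gam (Qmat y) (Pmat y) *m h) h.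
Proof.
have key (D1 D2 q : R) : m * q <= D2 -> - (m / 2 * q) <= D1 - D2 -> m / 2 * q <= D1.
  by move=> h1 h2; lra.
move=> m0 coer; have m2 : 0 < m / 2 by rewrite divr_gt0.
have : \forall y \near xs, mnorm (Bmat gam (Qmat y) (Pmat y) - Bstar) < m / 2.
  apply: (@mnorm_cvg R n _ (nbhs xs) _ (fun y => Bmat gam (Qmat y) (Pmat y))) => //.
  by apply: Bmat_cvg_entry; [exact: Qmat_cvg_entry|exact: Pmat_cvg_entry].
apply: filterS => y; set B := Bmat _ _ _ => By h.
have e1 : `|dot (B *m h) h - dot (Bstar *m h) h| <= mnorm (B - Bstar) * enorm h ^+ 2.
  have -> : dot (B *m h) h - dot (Bstar *m h) h = dot ((B - Bstar) *m h) h.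
    by rewrite mulmxBl dotDl dotNl.
  apply: le_trans (abs_dot_le _ _) _; rewrite expr2 mulrA ler_wpM2r ?enorm_ge0 //.
  exact: enorm_mulmx.
have := le_trans e1 (ler_wpM2r (sqr_ge0 (enorm h)) (ltW By)).
rewrite ler_norml => /andP[e2 _].
exact: key (coer h) e2.
Qed.

End LocalStructure.

(** * Sufficient decrease, the quasi-Newton estimate, bounds near a root *)

Section Sequences.
Variables (R : realType) (n : nat).
Local Notation vec := 'cV[R]_n.
Local Notation mat := 'M[R]_n.

Lemma sufficient_decrease_cvg0 (u a : nat -> R) (M : R) :
  (forall k, 0 <= a k) -> (forall k, u k.+1 <= u k - a k) -> (forall k, M <= u k) ->
  a @ \oo --> 0.
Proof.
move=> a0 ua uM.
have u_dec : nonincreasing_seq u.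
  by apply/nonincreasing_seqP => k; apply: le_trans (ua k) _; rewrite gerBl.
have u_cvg : cvgn u.
  by apply: nonincreasing_is_cvgn => //; exists M => _ [k _ <-].
have uS : (fun k => u k.+1) @ \oo --> limn u by rewrite (cvg_shiftS u).
have du : (fun k => u k - u k.+1) @ \oo --> 0.
  by rewrite -(subrr (limn u)); exact: cvgB u_cvg uS.
apply: squeeze_cvgr (cvg_cst 0) du; apply: nearW => k.
by rewrite a0 lerBrDr addrC -lerBrDr ua.
Qed.

Lemma coercive_enorm_le (B : mat) (m : R) :
  (forall h, m * enorm h ^+ 2 <= dot (B *m h) h) ->
  forall h, m * enorm h <= enorm (B *m h).
Proof.
move=> coer h; have [h0|h0] := eqVneq (enorm h) 0.
  by rewrite h0 mulr0 enorm_ge0.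
have hp : 0 < enorm h by rewrite lt_def h0 enorm_ge0.
by rewrite -(ler_pM2r hp) -mulrA -expr2; apply: le_trans (coer h) (dot_le_enorm _ _).
Qed.

(** [v] is nearly [B y] and nearly [- B d], so [B (y + d)] is a difference of two errors. With
    [|d| <= |y + d| + |y|], the condition [e <= m / 2] absorbs the [|y + d|] term into half of the
    left side; the remaining [2 e |y|] is doubled to give the factor 4. *)
Lemma quasi_newton_step (B : mat) (m e : R) (v y d : vec) :
  (forall h, m * enorm h ^+ 2 <= dot (B *m h) h) ->
  0 <= e -> e <= m / 2 ->
  enorm (v - B *m y) <= e * enorm y -> enorm (v + B *m d) <= e * enorm d ->
  m * enorm (y + d) <= 4 * e * enorm y.
Proof.
have key (p q r : R) : m * p <= e * r + e * q -> e * r <= e * (p + q) ->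
    e * p <= m / 2 * p -> m * p <= 4 * e * q by move=> *; lra.
move=> coer e0 em vy vd.
have h1 : enorm (B *m (y + d)) <= e * enorm d + e * enorm y.
  have -> : B *m (y + d) = (v + B *m d) - (v - B *m y).
    rewrite mulmxDr; move: (B *m y) (B *m d) => a b.
    by apply/colP => i; rewrite !mxE; ring.
  by apply: le_trans (ler_enormB _ _) _; rewrite lerD.
have h2 := coercive_enorm_le coer (y + d).
have h3 : enorm d <= enorm (y + d) + enorm y.
  by have := ler_enormB (y + d) y; rewrite [y + d]addrC addrK.
have h4 := ler_wpM2l e0 h3; have h5 := ler_wpM2r (enorm_ge0 (y + d)) em.
exact: key (le_trans h2 h1) h4 h5.
Qed.

Lemma near_S (P : set nat) :
  (\forall k \near \oo, P k) -> \forall k \near \oo, P k.+1.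
Proof. by move=> [N _ NP]; exists N => // k /= Nk; apply: NP; exact: leqW. Qed.

End Sequences.

Lemma hasjac_root (R : realType) (n : nat) (F : 'cV[R]_n -> 'cV[R]_n) x J :
  hasjac F x J -> F x = 0 -> forall e : R, 0 < e ->
  \forall y \near x, enorm (F y - J *m (y - x)) <= e * enorm (y - x).
Proof. by move=> FJ F0 e e0; apply: filterS (FJ e e0) => y; rewrite F0 subr0. Qed.

Lemma hasjac_root_lipschitz (R : realType) (n : nat) (F : 'cV[R]_n -> 'cV[R]_n) x J :
  hasjac F x J -> F x = 0 ->
  \forall y \near x, enorm (F y) <= (mnorm J + 1) * enorm (y - x).
Proof.
by move=> FJ F0; apply: filterS (hasjac_lipschitz FJ) => y; rewrite F0 subr0.
Qed.

(** Coercivity of [Q J] makes [J] injective with constant [m / q], and half of it pays for the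
    remainder. This will bound the residual from below by the distance to the solution. *)
Lemma hasjac_root_lower_bound (R : realType) (n : nat) (F : 'cV[R]_n -> 'cV[R]_n)
    (x : 'cV[R]_n) (J Q : 'M[R]_n) (m : R) :
  hasjac F x J -> F x = 0 -> 0 < m ->
  (forall h, m * enorm h ^+ 2 <= dot (Q *m J *m h) h) ->
  exists2 c : R, 0 < c & \forall y \near x, c * enorm (y - x) <= enorm (F y).
Proof.
move=> FJ F0 m0 coer; pose q := mnorm Q + 1.
have q0 : 0 < q by rewrite ltr_wpDl ?mnorm_ge0.
have c0 : 0 < m / q / 2 by rewrite !divr_gt0.
exists (m / q / 2) => //; apply: filterS (FJ _ c0) => y; rewrite F0 subr0 => h1.
have h2 : m / q * enorm (y - x) <= enorm (J *m (y - x)).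
  rewrite mulrAC ler_pdivrMr //.
  apply: le_trans (coercive_enorm_le coer (y - x)) _; rewrite -mulmxA.
  apply: le_trans (enorm_mulmx _ _) _.
  by rewrite mulrC ler_wpM2l ?enorm_ge0 // lerDl.
have h3 := ler_enormB (F y) (F y - J *m (y - x)).
rewrite opprB addrC subrK in h3.
have key (a b c d : R) : d <= a / 2 * b -> a * b <= c -> forall e, c <= e + d ->
  a / 2 * b <= e by move=> *; lra.
exact: key h1 h2 _ h3.
Qed.

Lemma cvg_near_comp (T : topologicalType) (u : nat -> T) (l : T) (U : set T) :
  u @ \oo --> l -> (\forall y \near l, U y) -> \forall k \near \oo, U (u k).
Proof. by move=> ul /ul. Qed.

(** * The iterates: convergence, unit stepsize, superlinear rates *)

Section PGCL.
Variables (R : realType) (n : nat).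
Local Notation vec := 'cV[R]_n.
Local Notation mat := 'M[R]_n.
Variables (f : vec -> R) (g : vec -> \bar R) (Lf gam sigma beta mu : R).
Variables (x xbar r rbar d s : nat -> vec) (Q P : nat -> mat) (tau : nat -> R).
Variables (xs : vec) (F : vec -> vec).
Hypotheses (df : forall y, differentiable f y)
  (f_lip : forall y z, enorm (grad f y - grad f z) <= Lf * enorm (y - z))
  (g_proper : proper_fun g)
  (phi_min : exists x0, forall y, ((f x0)%:E + g x0 <= (f y)%:E + g y)%E)
  (gam0 : 0 < gam) (gamL : gam * Lf < 1)
  (sigma0 : 0 < sigma) (sigma_lt : sigma < gam * (1 - gam * Lf) / 2)
  (mu0 : 0 < mu).

Local Notation W y := (fine (fbe gam f g y)).
Local Notation B k := (Bmat gam (Q k) (P k)).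
Definition pgcl_accept k (t : R) : Prop :=
  (fbe gam f g (xbar k + t ^+ 2 *: d k + t *: s k)
     <= fbe gam f g (x k) - (sigma * enorm (r k) ^+ 2)%:E
        + (mu / 2 * t ^+ 2 * dot (B k *m s k) (s k))%:E)%E.

Hypotheses
  (xbarT : forall k, Tfb gam f g (x k) (xbar k))
  (rE : forall k, r k = gam^-1 *: (x k - xbar k))
  (rbarR : forall k, Rfb gam f g (xbar k) (rbar k))
  (QC : forall k, exists M, clarke_jac (fun y => [set grad f y]) (xbar k) M /\
                Q k = 1%:M - gam *: M)
  (PC : forall k, clarke_jac (prox gam g) (xbar k - gam *: grad f (xbar k)) (P k))
  (s_neg : forall k, ~ lambda_min_nonneg (B k) -> dot (B k *m s k) (s k) < 0)
  (s_null : forall k, lambda_min_nonneg (B k) -> dot (B k *m s k) (s k) = 0)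
  (tauE : forall k, exists m : nat, tau k = beta ^+ m /\ pgcl_accept k (beta ^+ m) /\
        forall m' : nat, (m' < m)%N -> ~ pgcl_accept k (beta ^+ m'))
  (xE : forall k, x k.+1 = xbar k + tau k ^+ 2 *: d k + tau k *: s k)
  (xbar_cvg : xbar @ \oo --> xs)
  (xs_min : strong_local_min (fun y => (f y)%:E + g y)%E xs)
  (f_C1 : C1_near (grad f) xs)
  (proxF : \forall y \near fwd gam f xs, prox gam g y = [set F y])
  (F_C1 : C1_near F (fwd gam f xs))
  (d_neq0 : \forall k \near \oo, d k != 0)
  (dennis_more : (fun k => enorm (Q k *m rbar k + hess (fun y => W y) xs *m d k)
            / enorm (d k)) @ \oo --> 0).

Lemma fbe_decrease k : W (x k.+1) <= W (x k) - sigma * enorm (r k) ^+ 2.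
Proof.
have [m [tm [acc _]]] := tauE k; move: acc; rewrite /pgcl_accept -tm -xE.
(* The envelope is finite at both iterates because [xbar k] and [xbar k.+1] attain the infima. *)
rewrite (fbe_fineK gam0 g_proper (xbarT k)) (fbe_fineK gam0 g_proper (xbarT k.+1)).
rewrite -EFinB -EFinD lee_fin => /le_trans; apply; rewrite gerDl.
have Bs0 : dot (B k *m s k) (s k) <= 0.
  by have [/s_null ->|/s_neg/ltW] := pselect (lambda_min_nonneg (B k)).
by rewrite mulr_ge0_le0 // mulr_ge0 ?sqr_ge0 // divr_ge0 // ltW.
Qed.

Lemma fbe_lower_bound : exists M : R, forall k, M <= W (x k).
Proof.
have [x0 min0] := phi_min; exists (f x0 + fine (g x0)) => k.
apply: le_trans (fbe_ge gam0 g_proper df f_lip (xbarT k)).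
apply: ler_wpDr.
  by rewrite mulr_ge0 ?sqr_ge0 ?divr_ge0 ?mulr_ge0 // ?subr_ge0 // ltW.
have gz := Tfb_fin_num g_proper (xbarT k).
have := min0 (xbar k); rewrite -(fineK gz) -EFinD.
have := g_proper.1 x0; case: (g x0) => // a _; by rewrite -EFinD lee_fin.
Qed.

Lemma residual_cvg0 (e : R) : 0 < e -> \forall k \near \oo, enorm (r k) < e.
Proof.
move=> e0; have [M WM] := fbe_lower_bound.
have a0 k : 0 <= sigma * enorm (r k) ^+ 2 by rewrite mulr_ge0 ?sqr_ge0 // ltW.
have := sufficient_decrease_cvg0 a0 fbe_decrease WM.
have se : 0 < sigma * e ^+ 2 by rewrite mulr_gt0 // exprn_gt0.
move=> /cvgr0Pnorm_lt /(_ _ se); apply: filterS => k.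
rewrite ger0_norm // ltr_pM2l // ltr_pXn2r ?nnegrE ?enorm_ge0 //.
exact: ltW.
Qed.

Lemma x_cvg : x @ \oo --> xs.
Proof.
apply/cvg_enorm => e e0; have e2 : 0 < e / 2 by rewrite divr_gt0.
have eg : 0 < e / 2 / gam by rewrite divr_gt0.
have /cvg_enorm/(_ _ e2) xb := xbar_cvg.
apply: filterS2 xb (residual_cvg0 eg) => k h1 h2.
have h3 : enorm (x k - xbar k) < e / 2.
  move: h2; rewrite rE enormZ gtr0_norm ?invr_gt0 // mulrC ltr_pM2r ?invr_gt0 //.
apply: le_lt_trans (ler_enorm_dist (xbar k) _ _) _.
by rewrite (splitr e) ltrD.
Qed.

Lemma xbar_Tmap : \forall k \near \oo, xbar k = Tmap gam f F (x k).
Proof.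
apply: filterS (cvg_near_comp x_cvg (Tfb_Tmap f_C1 proxF)) => k Tk.
by have := xbarT k; rewrite Tk.
Qed.

Lemma xs_fix : Tmap gam f F xs = xs.
Proof.
have Tc := hasjac_cvg (nbhs_singleton (Tmap_hasjac f_C1 F_C1)).
have Txc : (fun k => Tmap gam f F (x k)) @ \oo --> Tmap gam f F xs.
  exact: (cvg_comp x (Tmap gam f F) x_cvg Tc).
have xbc : xbar @ \oo --> Tmap gam f F xs.
  apply: cvg_trans Txc; apply: near_eq_cvg.
  by apply: filterS xbar_Tmap => k ->.
exact: (cvg_unique (@norm_hausdorff _ _) xbc xbar_cvg).
Qed.

Local Notation Bs := (Bstar gam f F xs).
Local Notation Qm := (Qmat gam f).
Local Notation Pm := (Pmat gam f F).
Local Notation Rm := (Rmap gam f F).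

Lemma Q_eq : \forall k \near \oo, Q k = Qm (xbar k).
Proof.
apply: filterS (cvg_near_comp xbar_cvg (clarke_forward gam f_C1)) => k Qk.
by have [M [MC QM]] := QC k; exact: Qk MC QM.
Qed.

Lemma P_eq : \forall k \near \oo, P k = Pm (xbar k).
Proof.
have PF := cvg_near_comp xbar_cvg (clarke_prox f_C1 proxF F_C1).
by apply: filterS PF => k Pk; exact: Pk (PC k).
Qed.

Lemma rbar_eq : \forall k \near \oo, rbar k = Rm (xbar k).
Proof.
apply: filterS (cvg_near_comp xbar_cvg (Tfb_Tmap f_C1 proxF)) => k Tk.
by have [z Tz <-] := rbarR k; move: Tz; rewrite Tk => ->.
Qed.

Lemma Bs_coercive :
  exists2 m : R, 0 < m & forall h, m * enorm h ^+ 2 <= dot (Bs *m h) h.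
Proof.
exact: (Bstar_coercive gam0 g_proper df f_C1 proxF F_C1 xs_fix gamL f_lip xs_min).
Qed.

Lemma QR_root : Qm xs *m Rm xs = 0.
Proof. by rewrite (Rmap_root xs_fix) mulmx0. Qed.

(** Coercivity of [B_k] puts the selection in the branch where the curvature along [s k] is 0, and
    then leaves 0 as the only vector of zero curvature. *)
Lemma s_eq0 : \forall k \near \oo, s k = 0.
Proof.
have [m m0 coer] := Bs_coercive.
have Bk := cvg_near_comp xbar_cvg (Bmat_coercive f_C1 F_C1 m0 coer).
apply: filterS3 Q_eq P_eq Bk => k Qk Pk; rewrite -Qk -Pk => coerk.
have pos h : 0 <= dot (B k *m h) h.
  by apply: le_trans (coerk h); rewrite mulr_ge0 ?sqr_ge0 // divr_ge0 // ltW.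
have := coerk (s k); rewrite (s_null (lambda_min_nonneg_coercive pos)).
rewrite pmulr_rle0 ?divr_gt0 // => s0; apply: enorm_eq0; apply/eqP.
by rewrite -sqrf_eq0 eq_le s0 sqr_ge0.
Qed.

Lemma newton_step (e : R) : 0 < e ->
  \forall k \near \oo, enorm (xbar k + d k - xs) <= e * enorm (xbar k - xs).
Proof.
move=> e0; have [m m0 coer] := Bs_coercive.
have key (t : R) : t <= m * e / 4 -> 4 * t <= m * e by move=> *; lra.
(* [m / 2] is the threshold of [quasi_newton_step]; [m * e / 4] brings its factor [4 h / m] down to
   [e]. *)
pose h := Num.min (m / 2) (m * e / 4).
have h0 : 0 < h by rewrite lt_min !divr_gt0 ?mulr_gt0.
have hm : h <= m / 2 by rewrite ge_min lexx.
have he : h <= m * e / 4 by rewrite ge_min lexx orbT.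
have hB : hess (fun y => W y) xs = Bs.
  exact: hess_fbe gam0 g_proper df f_C1 proxF F_C1 xs_fix.
have QRn := cvg_near_comp xbar_cvg (hasjac_root (QR_hasjac f_C1 F_C1 xs_fix) QR_root h0).
have DM : \forall k \near \oo,
    enorm (Q k *m rbar k + Bs *m d k) <= h * enorm (d k).
  have /cvgr0Pnorm_lt /(_ _ h0) DM := dennis_more.
  apply: filterS2 d_neq0 DM => k dk; rewrite hB ger0_norm ?divr_ge0 ?enorm_ge0 //.
  have dp : 0 < enorm (d k).
    rewrite lt_def enorm_ge0 andbT; apply: contra dk => /eqP/enorm_eq0 ->.
    exact: eqxx.
  by rewrite ltr_pdivrMr // => /ltW.
have QR : \forall k \near \oo,
    enorm (Q k *m rbar k - Bs *m (xbar k - xs)) <= h * enorm (xbar k - xs).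
  by apply: filterS3 Q_eq rbar_eq QRn => k -> ->.
apply: filterS2 QR DM => k h1 h2.
have := quasi_newton_step coer (ltW h0) hm h1 h2.
rewrite addrAC => E; rewrite -(ler_pM2l m0); apply: le_trans E _.
rewrite mulrA ler_wpM2r ?enorm_ge0 //.
exact: key he.
Qed.

(** [T] is Lipschitz at its fixed point. This turns [|x k.+1 - xs| = o(|xbar k - xs|)], which mixes
    the two sequences, into a rate for each of them. *)
Lemma xbar_lipschitz : exists2 c : R, 0 < c &
  \forall k \near \oo, enorm (xbar k - xs) <= c * enorm (x k - xs).
Proof.
have Tj := nbhs_singleton (Tmap_hasjac f_C1 F_C1).
exists (mnorm (Pm xs *m Qm xs) + 1); first by rewrite ltr_wpDl ?mnorm_ge0.
apply: filterS2 xbar_Tmap (cvg_near_comp x_cvg (hasjac_lipschitz Tj)) => k ->.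
by rewrite xs_fix.
Qed.

Lemma tau_eq1 : \forall k \near \oo, tau k = 1.
Proof.
have [c c0 [e e0 grow]] :=
  fbe_forward_growth gam0 g_proper df f_C1 proxF xs_fix f_lip xs_min.
have Rx : (Qm xs)^T *m Rm xs = 0 by rewrite (Rmap_root xs_fix) mulmx0.
have upper := quadratic_upper_bound
  (fbe_hasgrad gam0 g_proper df f_C1 proxF F_C1)
  (fbe_grad_hasjac df f_C1 F_C1 xs_fix) Rx.
pose b := mnorm Bs + 1.
have b0 : 0 < b by rewrite ltr_wpDl ?mnorm_ge0.
(* From [h <= 1] and [b h <= c] follows [b (h q)^2 <= c q^2]: at the unit step the envelope exceeds
   [W xs] by at most the growth term [c |xbar k - xs|^2]. *)
pose h := Num.min 1 (c / b).
have h0 : 0 < h by rewrite lt_min ltr01 divr_gt0.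
have h1 : h <= 1 by rewrite ge_min lexx.
have hb : b * h <= c by rewrite mulrC -ler_pdivlMr // ge_min lexx orbT.
have yc : (fun k => xbar k + d k) @ \oo --> xs.
  apply/cvg_enorm => t t0; have /cvg_enorm/(_ _ t0) xb := xbar_cvg.
  apply: filterS2 xb (newton_step ltr01) => k xk; rewrite mul1r => /le_lt_trans.
  exact.
have /cvg_enorm/(_ _ e0) xbe := xbar_cvg.
have up := cvg_near_comp yc upper.
have Ty := cvg_near_comp yc (Tfb_Tmap f_C1 proxF).
near=> k.
have sk : s k = 0 by near: k; exact: s_eq0.
have Nk : enorm (xbar k + d k - xs) <= h * enorm (xbar k - xs).
  by near: k; exact: newton_step.
have upk : `|W (xbar k + d k) - W xs| <= b * enorm (xbar k + d k - xs) ^+ 2.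
  by near: k.
have Tk : Tfb gam f g (xbar k + d k) (Tmap gam f F (xbar k + d k)).
  have -> : Tfb gam f g (xbar k + d k) = [set Tmap gam f F (xbar k + d k)].
    by near: k.
  by [].
have xk : enorm (xbar k - xs) < e by near: k.
have acc : pgcl_accept k 1.
  rewrite /pgcl_accept sk mulmx0 dot0r mulr0 scaler0 addr0 adde0 expr1n scale1r.
  rewrite (fbe_fineK gam0 g_proper Tk) (fbe_fineK gam0 g_proper (xbarT k)).
  rewrite -EFinB lee_fin.
  have low := grow _ _ (xbarT k) xk.
  have xr : enorm (xbar k - x k) = gam * enorm (r k).
    by rewrite rE enormZ gtr0_norm ?invr_gt0 // mulrA mulfV ?gt_eqF // mul1r enormBC.
  (* As [|xbar k - x k| = gam |r k|], the upper bound imposed on [sigma] is exactly what this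
     comparison asks for. *)
  have sr : sigma * enorm (r k) ^+ 2 <=
      (1 - gam * Lf) / (2 * gam) * enorm (xbar k - x k) ^+ 2.
    rewrite xr exprMn [leRHS]mulrA ler_wpM2r ?sqr_ge0 //; apply: ltW.
    suff -> : (1 - gam * Lf) / (2 * gam) * gam ^+ 2 = gam * (1 - gam * Lf) / 2 by [].
    by field; exact: lt0r_neq0.
  have up2 : b * enorm (xbar k + d k - xs) ^+ 2 <= c * enorm (xbar k - xs) ^+ 2.
    apply: (@le_trans _ _ (b * (h * enorm (xbar k - xs)) ^+ 2)).
      by rewrite ler_pM2l // ler_pXn2r ?nnegrE ?enorm_ge0 // mulr_ge0 ?enorm_ge0 // ltW.
    rewrite exprMn [leLHS]mulrA ler_wpM2r ?sqr_ge0 //; apply: le_trans hb.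
    by rewrite expr2 mulrA ler_piMr // mulr_ge0 // ltW.
  move: upk; rewrite ler_norml => /andP[_ upk].
  have key (w1 w0 wk p q t u : R) : w1 - w0 <= p -> p <= q -> w0 + q + u <= wk ->
    t <= u -> w1 <= wk - t by move=> *; lra.
  exact: key upk up2 low sr.
(* The stepsize is the first accepted power, and acceptance of [beta ^+ 0 = 1] rules out every later
   exponent. *)
have [[|m'] [-> [_ minm]]] := tauE k; first by rewrite expr0.
by case: (minm 0%N (ltn0Sn _)); rewrite expr0.
Unshelve. all: by end_near. Qed.

Lemma x_next : \forall k \near \oo, x k.+1 = xbar k + d k.
Proof.
apply: filterS2 tau_eq1 s_eq0 => k tk sk.
by rewrite xE tk sk scaler0 addr0 expr1n scale1r.
Qed.

Lemma x_superlinear : superlinear x xs.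
Proof.
apply: superlinear_intro x_cvg _ => e e0.
have [c c0 lip] := xbar_lipschitz.
have ec : 0 < e / c by rewrite divr_gt0.
apply: filterS3 x_next lip (newton_step ec) => k -> h1 h2.
apply: le_trans h2 _; rewrite -mulrA ler_pM2l //.
by rewrite ler_pdivrMl.
Qed.

Lemma xbar_superlinear : superlinear xbar xs.
Proof.
apply: superlinear_intro xbar_cvg _ => e e0.
have [c c0 lip] := xbar_lipschitz.
have ec : 0 < e / c by rewrite divr_gt0.
apply: filterS3 x_next (near_S lip) (newton_step ec) => k -> h1 h2.
apply: le_trans h1 _; rewrite mulrC -ler_pdivlMr // mulrAC.
exact: h2.
Qed.

(** [|r k|] is comparable with [|x k - xs|] from both sides: above because [R] is Lipschitz at its
    root, below by coercivity of the Hessian, which has the Jacobian of [R] as a factor. *)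
Lemma r_superlinear : superlinear r 0.
Proof.
have r_cvg : r @ \oo --> (0 : vec).
  apply/cvg_enorm => e e0; apply: filterS (residual_cvg0 e0) => k.
  by rewrite subr0.
apply: superlinear_intro r_cvg _ => e e0.
have [m m0 coer] := Bs_coercive.
have Rj := nbhs_singleton (Rmap_hasjac f_C1 F_C1).
rewrite BstarE in coer.
have [c c0 low] := hasjac_root_lower_bound Rj (Rmap_root xs_fix) m0 coer.
pose C := mnorm (gam^-1 *: (1%:M - Pm xs *m Qm xs)) + 1.
have C0 : 0 < C by rewrite ltr_wpDl ?mnorm_ge0.
have rR : \forall k \near \oo, r k = Rm (x k).
  by apply: filterS xbar_Tmap => k xk; rewrite rE xk.
have [a a0 lip] := xbar_lipschitz.
(* Chosen to cancel [C] and [a], leaving [e * (c |x k - xs|)], which is at most [e |r k|]. *)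
have ea : 0 < e * c / C / a by rewrite !divr_gt0 // mulr_gt0.
have rlow : \forall k \near \oo, c * enorm (x k - xs) <= enorm (r k).
  by apply: filterS2 rR (cvg_near_comp x_cvg low) => k ->.
have rup : \forall k \near \oo, enorm (r k) <= C * enorm (x k - xs).
  have Rl := hasjac_root_lipschitz Rj (Rmap_root xs_fix).
  apply: filterS2 rR (cvg_near_comp x_cvg Rl) => k ->.
  exact.
have rupS := near_S rup.
near=> k; rewrite !subr0.
have n1 : x k.+1 = xbar k + d k by near: k; exact: x_next.
have n2 : enorm (xbar k - xs) <= a * enorm (x k - xs) by near: k.
have n3 : enorm (xbar k + d k - xs) <= e * c / C / a * enorm (xbar k - xs).
  by near: k; exact: newton_step.
have n4 : c * enorm (x k - xs) <= enorm (r k) by near: k.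
have n5 : enorm (r k.+1) <= C * enorm (x k.+1 - xs) by near: k.
apply: le_trans n5 _; rewrite n1.
apply: le_trans (ler_wpM2l (ltW C0) n3) _.
apply: le_trans (ler_wpM2l (ltW C0) (ler_wpM2l (ltW ea) n2)) _.
have -> : C * (e * c / C / a * (a * enorm (x k - xs))) = e * (c * enorm (x k - xs)).
  by field; rewrite !gt_eqF.
by rewrite ler_pM2l.
Unshelve. all: by end_near. Qed.

Lemma pgcl_superlinear :
  (\forall k \near \oo, tau k = 1) /\
  superlinear x xs /\ superlinear xbar xs /\ superlinear r 0.
Proof.
split; first exact: tau_eq1.
split; first exact: x_superlinear.
by split; [exact: xbar_superlinear|exact: r_superlinear].
Qed.

End PGCL.

Unset Implicit Arguments.

Theorem theorem5p6 (R : realType) (n : nat)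
  (f : 'cV[R]_n -> R) (g : 'cV[R]_n -> \bar R)
  (Lf : R) (gam_g : \bar R) (rho : R)
  (gam sigma beta mu : R)
  (x xbar r rbar d s : nat -> 'cV[R]_n) (Q P : nat -> 'M[R]_n) (tau : nat -> R)
  (xstar : 'cV[R]_n) :
  (* assumptions on f *)
  (forall y, differentiable f y) ->
  0 <= Lf ->
  (forall y z, enorm (grad f y - grad f z) <= Lf * enorm (y - z)) ->
  (* assumptions on g *)
  proper_fun g -> lower_semicontinuous g ->
  (0 < gam_g)%E -> prox_bounded gam_g g -> weakly_convex rho g ->
  (* argmin (f + g) nonempty *)
  (exists x0, forall y, ((f x0)%:E + g x0 <= (f y)%:E + g y)%E) ->
  (* parameters of PGCL *)
  0 < gam -> gam * Lf < 1 -> (gam%:E < gam_g)%E ->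
  0 < sigma -> sigma < gam * (1 - gam * Lf) / 2 ->
  0 < beta < 1 -> 0 < mu < 1 ->
  (* the iterations of PGCL (which never stops) *)
  (forall k,
     Tfb gam f g (x k) (xbar k) /\
     r k = gam^-1 *: (x k - xbar k) /\
     Rfb gam f g (xbar k) (rbar k) /\
     (exists M, clarke_jac (fun y => [set grad f y]) (xbar k) M /\
                Q k = 1%:M - gam *: M) /\
     clarke_jac (prox gam g) (xbar k - gam *: grad f (xbar k)) (P k) /\
     ~ (rbar k = 0 /\ lambda_min_nonneg (Bmat gam (Q k) (P k))) /\
     dot (Q k *m rbar k) (d k) <= 0 /\
     dot (Q k *m rbar k) (s k) <= 0 /\
     (~ lambda_min_nonneg (Bmat gam (Q k) (P k)) ->
        dot (Bmat gam (Q k) (P k) *m s k) (s k) < 0) /\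
     (lambda_min_nonneg (Bmat gam (Q k) (P k)) ->
        dot (Bmat gam (Q k) (P k) *m s k) (s k) = 0) /\
     (let accept (t : R) :=
        (fbe gam f g (xbar k + t ^+ 2 *: d k + t *: s k)
         <= fbe gam f g (x k) - (sigma * enorm (r k) ^+ 2)%:E
            + (mu / 2 * t ^+ 2 * dot (Bmat gam (Q k) (P k) *m s k) (s k))%:E)%E in
      exists m : nat, tau k = beta ^+ m /\ accept (beta ^+ m) /\
        forall m' : nat, (m' < m)%N -> ~ accept (beta ^+ m')) /\
     x k.+1 = xbar k + tau k ^+ 2 *: d k + tau k *: s k) ->
  (* (xbar^k) converges to a strong local minimizer with the smoothness assumptions *)
  xbar @ \oo --> xstar ->
  strong_local_min (fun y => (f y)%:E + g y)%E xstar ->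
  Ck_near 3 f xstar ->
  prox_C1_near gam g (xstar - gam *: grad f xstar) ->
  (* Dennis-More condition *)
  (\forall k \near \oo, d k != 0) ->
  (fun k => enorm (Q k *m rbar k + hess (fun y => fine (fbe gam f g y)) xstar *m d k)
            / enorm (d k)) @ \oo --> 0 ->
  (* conclusion *)
  (\forall k \near \oo, tau k = 1) /\
  superlinear x xstar /\ superlinear xbar xstar /\ superlinear r 0.
Proof.
move=> df _ f_lip g_proper _ _ _ _ phi_min gam0 gamL _ sigma0 sigma_lt _ /andP[mu0 _].
move=> pgcl xbar_cvg xs_min f_C3 [F [proxF F_C1]] d_neq0 dennis_more.
apply: (@pgcl_superlinear R n f g Lf gam sigma beta mu x xbar r rbar d s Q P tau xstar F)
  => //; try by move=> k; have := pgcl k; tauto.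
- exact: Ck_near2_C1_grad (Ck_nearW f_C3).
- exact: Ck_near1_C1 F_C1.
Qed.
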